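(* Let $(\mathcal K,L,C)$ be a defining triple and consider the associated generalised Mayer problem. Let $U_o\in\mathcal K$ and let $\gamma_o=\gamma^{(U_o)}$ be the corresponding $\mathcal K$-controlled curve. For a $\mathcal K$-controlled variation $F(t,s)=\gamma^{(U(s))}(t)$, $U(s)=(u^{(s)},\sigma^{(s)})$, put $\sigma^{(s)}_t=j^n_t(\gamma^{(U(s))})$, $Y^a=\partial u^{(s)a}(t)/\partial s$, and let $\mu'=\mu'(t,s)$ be the function associated with $F$ defined in the context. (a) A necessary condition for $\gamma_o$ to be a solution to the generalised Mayer problem is that for every $\mathcal K$-controlled variation $F$ with $F(\cdot,0)=\gamma_o$ one has $$\int_0^T\left(\int_0^1\left(Y^a\,\frac{\partial \mathcal P_{\sigma^{(s)}_t}}{\partial u^a}\bigg|_{u^{(s)}(t)}-\frac{\partial^2\mu'}{\partial t\,\partial s}\bigg|_{(t,s)}\right)ds\right)dt\ \le\ 0$$ (sum over the repeated index $a$). (b) In case the problem is such that for any two $\mathcal K$-controlled curves $\gamma^{(U)}$, $\gamma^{(U')}$ there is a $\mathcal K$-controlled variation which has them as endpoints, the condition in (a) is also sufficient.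
   Context: **Setting.** $T>0$; $\mathcal Q$ is an $N$-dimensional manifold, with (local) coordinates denoted by $(q^1,\dots,q^N)$, in which the formulas below are written. Curves are parameterised graphs $\gamma(t)=(t,q(t))$, $t\in[0,T]$. $J^n(\mathcal Q|\mathbb R)$ is the manifold of $n$-jets $j^n_t(\gamma)$ of such curves, with coordinates $(t,q^i_{(\beta)})$, $0\le\beta\le n$, where $q^i_{(\beta)}=d^\beta q^i/dt^\beta$. A function on the jet space (possibly depending also on controls) has actual order $k$ if it does not depend on the $q^i_{(\beta)}$ with $\beta>k$. $K\subset\mathbb R^M$ is the closure of a bounded open set with smooth boundary; its points are $u=(u^a)$. The total derivative of a function $f$ on $J^n(\mathcal Q|\mathbb R)\times K$ of actual order $r'$ is $\frac{df}{dt}=\frac{\partial f}{\partial t}+\sum_{j=1}^N\sum_{\delta=0}^{r'}\frac{\partial f}{\partial q^j_{(\delta)}}q^j_{(\delta+1)}$. **Defining triple** $(\mathcal K,L,C)$. * $L:J^n(\mathcal Q|\mathbb R)\times K\to\mathbb R$ is smooth of actual order $r\ge1$, with $2r+1\le n$. Given a smooth control curve $u:[0,T]\to K$, the controlled Euler–Lagrange equations for $\gamma$ are $$\Big(\frac{\partial L}{\partial q^i}+\sum_{\beta=1}^r(-1)^\beta\Big(\frac{d}{dt}\Big)^\beta\Big(\frac{\partial L}{\partial q^i_{(\beta)}}\Big)\Big)\Big|_{(j^n_t(\gamma),u(t))}=0,\qquad i=1,\dots,N.$$ * $\mathcal K$ is a set of pairs $U=(u(\cdot),\sigma)$, with $u:[0,T]\to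 K$ smooth and $\sigma$ a $(2r-1)$-jet at $t=0$, possibly subject to given constraints. Standing assumption: for each $U\in\mathcal K$ there is a unique solution $\gamma^{(U)}$ on $[0,T]$ of the controlled Euler–Lagrange equations with $j^{2r-1}_{t=0}(\gamma)=\sigma$. The curves $\gamma^{(U)}$ are called $\mathcal K$-controlled. * $C:J^n(\mathcal Q|\mathbb R)\to\mathbb R$ is smooth, of some actual order $\tilde r\le n-1$, and vanishes identically on jets at $t=0$. The terminal cost of $\gamma^{(U)}$ is $C(j^n_{t=T}(\gamma^{(U)}))$. **Generalised Mayer problem**: $\gamma^{(U)}$ is a solution if its terminal cost is minimal among the terminal costs of all $\mathcal K$-controlled curves. **$\mathcal K$-controlled variation** of $\gamma^{(U_o)}$: a smooth map $F(t,s)=\gamma^{(U(s))}(t)$, $(t,s)\in[0,T]\times[0,1]$, where $U(s)=(u^{(s)},\sigma^{(s)})$ is a smooth curve in $\mathcal K$ with $U(0)=U_o$; its endpoints are the curves $F(\cdot,0)$ and $F(\cdot,1)$. **The function $\mathcal P$**: for a jet $j$, $\mathcal P_j:K\to\mathbb R$, $\mathcal P_j(u)=-L(j,u)$. **The functions $\mathbf h,\mathbf h',\mathbf h''$.** For a function $\Lambda$ and $0\le\beta\le r-1$ put $p_i^\beta[\Lambda]=\sum_{\delta=\beta+1}^{r}(-1)^{\delta-\beta-1}\frac{d^{\delta-\beta-1}}{dt^{\delta-\beta-1}}\big(\frac{\partial\Lambda}{\partial q^i_{(\delta)}}\big)$ ($d/dt$ the total derivative), evaluated at the jets of the curve and at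 its control. To each controlled curve and $1\le i\le N$, $0\le\beta\le r-1$, associate the unique functions on $[0,T]$ (a subscript $(k)$ denotes the $k$-th $t$-derivative) with * $\mathbf h^i_{\beta(2)}=\mathbf h^i_\beta$, $\ \mathbf h^i_\beta(0)=q^i_{(\beta)}(0)$, $\ \mathbf h^i_{\beta(1)}(0)=-p^\beta_i[L]|_{t=0}$; * $\mathbf h'^i_{\beta(4)}=(\frac{\pi}{2T})^4\mathbf h'^i_\beta$, $\ \mathbf h'^i_\beta(0)=\mathbf h'^i_{\beta(1)}(0)=0$, $\ \mathbf h'^i_{\beta(1)}(T)=q^i_{(\beta)}(T)$, $\ \mathbf h'^i_{\beta(2)}(T)=p^\beta_i[L+\frac{dC}{dt}]|_{t=T}$; * $\mathbf h''^i_{\beta(4)}=(\frac{\pi}{2T})^4\mathbf h''^i_\beta$, $\ \mathbf h''^i_\beta(0)=\mathbf h''^i_{\beta(1)}(0)=0$, $\ \mathbf h''^i_{\beta(1)}(T)=\mathbf h^i_\beta(T)$, $\ \mathbf h''^i_{\beta(2)}(T)=\mathbf h^i_{\beta(1)}(T)$. **The functions $\mu,\mu'$.** For a $\mathcal K$-controlled variation $F$, let $\mathbf h(t,s),\mathbf h'(t,s),\mathbf h''(t,s)$ be the functions associated with $\gamma^{(U(s))}$, and define $$\mu(t,s)=-\int_0^t\Big(L+\tfrac12\sum_{i=1}^N\sum_{\beta=0}^{r-1}\big[(\mathbf h^i_{\beta(1)})^2-(\mathbf h'^i_{\beta(2)})^2-(\mathbf h''^i_{\beta(2)})^2+(\mathbf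 h^i_\beta)^2+(\tfrac{\pi}{2T})^4(\mathbf h'^i_\beta)^2+(\tfrac{\pi}{2T})^4(\mathbf h''^i_\beta)^2\big]\Big)\Big|_{(\vartheta,s)}d\vartheta,$$ with $L$ evaluated at $(j^n_\vartheta(\gamma^{(U(s))}),u^{(s)}(\vartheta))$, and $$\mu'(t,s)=\mu(t,s)+\sum_{\beta=0}^{r-1}\sum_{i=1}^N\int_0^s\Big(\mathbf h'^i_{\beta(3)}\frac{\partial\mathbf h'^i_\beta}{\partial s}+\mathbf h''^i_{\beta(3)}\frac{\partial\mathbf h''^i_\beta}{\partial s}\Big)\Big|_{(t,v)}dv .$$
   Formalization: Formalized with the actual order of C at most r-1 (not n-1), and with d/dt in the Euler-Lagrange equations and momenta taken after substituting u(t), so that it includes the du/dt terms; (b) is false otherwise. Q is taken as one coordinate domain in R^N. *)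

(* Defs.v *)
From HB Require Import structures.
From mathcomp Require Import all_boot all_order all_algebra.
From mathcomp Require Import all_classical all_reals all_analysis.

Set Implicit Arguments.
Unset Strict Implicit.
Unset Printing Implicit Defensive.

Import Order.TTheory GRing.Theory Num.Theory.
Import numFieldNormedType.Exports.

Local Open Scope classical_set_scope.
Local Open Scope ring_scope.

(* Smooth functions on a set that is not open, such as [[0, T]],
   [[0, T] x [0, 1]] or [J^n x K], are represented throughout by functions
   that are smooth on an open neighbourhood of that set (on all of [R], of
   [R * R], of [J^n x R^M]).  At the points of these sets, each being the
   closure of its interior, all derivatives are determined by the restriction
   to the set, so nothing below depends on the chosen extension. *)

Notation jet R N n := (R * 'M[R]_(n.+1, N))%type.

Section Smooth.
Context {R : realType}.

(* All iterated directional derivatives of [f] are differentiable on [A];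
   [A] is meant to be open. *)
Definition smooth_on (V W : normedModType R) (A : set V) (f : V -> W) : Prop :=
  forall (vs : seq V) (x : V), A x ->
    differentiable (foldr (fun v g => fun y => 'D_v g y) f vs) x.

Definition smooth_boundary (V : normedModType R) (W : set V) : Prop :=
  forall x, (closure W `\` W) x ->
    exists (O : set V) (rho : V -> R),
      [/\ open O, O x, smooth_on O rho, exists v, 'D_v rho x != 0
        & W `&` O = [set y | O y /\ rho y < 0]].

(* The closure of a bounded open set with smooth boundary. *)
Definition control_domain (V : normedModType R) (K : set V) : Prop :=
  exists W : set V,
    [/\ open W, bounded_set W, smooth_boundary W & K = closure W].

End Smooth.

Section Jets.
Context {R : realType} {N n : nat}.

(* An [n]-jet is given by [t] and the matrix of the [q^i_(beta)], with row
   [beta] and column [i].  [Q], an open subset of [R^N], is the range of the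
   coordinates [q^i] of the manifold. *)
Definition Jn (Q : set 'rV[R]_N) : set (jet R N n) :=
  [set x | Q (row ord0 x.2)].

Implicit Types f : jet R N n -> R.

Definition has_actual_order (Q : set 'rV[R]_N) (k : nat) f : Prop :=
  forall x y, Jn Q x -> Jn Q y -> x.1 = y.1 ->
    (forall (beta : 'I_n.+1) i, (beta <= k)%N -> x.2 beta i = y.2 beta i) ->
    f x = f y.

Definition ddt f x : R := 'D_(1, 0) f x.

Definition ddq (beta : nat) (i : 'I_N) f x : R :=
  'D_(0, delta_mx (inord beta) i) f x.

(* The sum contains all terms that make sense on [J^n]; for [f] of actual
   order [r' <= n - 1] those with [delta > r'] vanish. *)
Definition total_derivative f x : R :=
  ddt f x + \sum_(j < N) \sum_(delta < n)
              ddq delta j f x * x.2 (inord delta.+1) j.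

(* [p_i^beta [f]]; the sum up to [r] gives the momenta of [f] when [f] has
   actual order [r].  For [f = L + dC/dt] this means that [C] has actual order
   at most [r - 1]. *)
Definition momentum (r beta : nat) (i : 'I_N) f x : R :=
  \sum_(beta.+1 <= delta < r.+1)
    (-1) ^+ (delta - beta - 1) *
    iter (delta - beta - 1) total_derivative (ddq delta i f) x.

Definition EL_operator (r : nat) (i : 'I_N) f x : R :=
  ddq 0 i f x + \sum_(1 <= beta < r.+1)
    (-1) ^+ beta * iter beta total_derivative (ddq beta i f) x.

End Jets.

Section Curves.
Context {R : realType} {N : nat}.

Definition deriv_matrix (k : nat) (q : R -> 'rV[R]_N) (t : R) : 'M[R]_(k, N) :=
  \matrix_(beta < k, i < N) derive1n beta q t 0 i.

Definition njet (n : nat) (q : R -> 'rV[R]_N) (t : R) :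
  jet R N n := (t, deriv_matrix n.+1 q t).

End Curves.

Section MayerProblem.
Context {R : realType}.
Variables (T : R) (N M n r rt : nat) (Q : set 'rV[R]_N) (K : set 'rV[R]_M).

(* A control curve and the coordinates [q^i_(beta)], [beta <= 2r - 1], of a
   [(2r - 1)]-jet at [t = 0]. *)
Definition control_pair : Type :=
  ((R -> 'rV[R]_M) * 'M[R]_(2 * r, N))%type.

(* [L] along a control curve, a function on [J^n].  Its total derivatives are
   taken after this substitution, hence account for the time dependence of
   the control; with [u] frozen the Euler-Lagrange expression would not be
   the one of the Lagrangian [L (_, u(t))]. *)
Definition controlled (L : (jet R N n) * 'rV[R]_M -> R)
    (u : R -> 'rV[R]_M) : jet R N n -> R :=
  fun x => L (x, u x.1).

Definition EL_solution (L : (jet R N n) * 'rV[R]_M -> R)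
    (U : control_pair) (q : R -> 'rV[R]_N) : Prop :=
  [/\ smooth_on setT q,
      forall t, t \in `[0, T] -> Q (q t),
      forall t i, t \in `[0, T] ->
        EL_operator r i (controlled L U.1) (njet n q t) = 0
    & deriv_matrix (2 * r) q 0 = U.2].

Record defining_triple := DefiningTriple {
  dtK : set control_pair;
  dtL : (jet R N n) * 'rV[R]_M -> R;
  dtC : jet R N n -> R;
  r_gt0 : (1 <= r)%N;
  r_le_n : (2 * r + 1 <= n)%N;
  rt_le_n : (rt <= n - 1)%N;
  dtL_smooth : smooth_on [set xw | Jn Q xw.1] dtL;
  dtL_order : forall w, K w -> has_actual_order Q r (fun x => dtL (x, w));
  dtK_control : forall U, dtK U ->
    smooth_on setT U.1 /\ forall t, t \in `[0, T] -> K (U.1 t);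
  (* Membership only depends on the control curve on [[0, T]]. *)
  dtK_restr : forall u v sigma, smooth_on setT v ->
    (forall t, t \in `[0, T] -> u t = v t) -> dtK (u, sigma) -> dtK (v, sigma);
  dtK_sol : forall U, dtK U -> exists2 q, EL_solution dtL U q &
    forall q', EL_solution dtL U q' -> forall t, t \in `[0, T] -> q' t = q t;
  dtC_smooth : smooth_on (Jn Q) dtC;
  dtC_order : has_actual_order Q rt dtC;
  dtC_0 : forall x, Jn Q x -> x.1 = 0 -> dtC x = 0
}.

Variable D : defining_triple.

(* [q] is the curve [gamma^(U)]. *)
Definition is_curve_of (U : control_pair) (q : R -> 'rV[R]_N) : Prop :=
  dtK D U /\ EL_solution (dtL D) U q.

Definition terminal_cost (q : R -> 'rV[R]_N) : R := dtC D (njet n q T).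

Definition mayer_solution (q : R -> 'rV[R]_N) : Prop :=
  forall U q', is_curve_of U q' -> terminal_cost q <= terminal_cost q'.

Record controlled_variation := ControlledVariation {
  var_u : R * R -> 'rV[R]_M;
  var_sigma : R -> 'M[R]_(2 * r, N);
  var_F : R * R -> 'rV[R]_N;
  var_u_smooth : smooth_on setT var_u;
  var_sigma_smooth : smooth_on setT var_sigma;
  var_F_smooth : smooth_on setT var_F;
  var_curve : forall s, s \in `[0, 1] ->
    is_curve_of (fun t => var_u (t, s), var_sigma s) (fun t => var_F (t, s))
}.

Definition has_endpoints (F : controlled_variation) (q q' : R -> 'rV[R]_N) :
    Prop :=
  forall t, t \in `[0, T] -> var_F F (t, 0) = q t /\ var_F F (t, 1) = q' t.

Definition calP (x : jet R N n) (w : 'rV[R]_M) : R := - dtL D (x, w).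

Definition omega4 : R := (pi / (2 * T)) ^+ 4.

(* The functions [h], [h'], [h''] are extended from [[0, T]] to [R] by their
   differential equations, which makes them unique as functions on [R]. *)
Definition ode2_solution (a b : R) : R -> R :=
  get [set h : R -> R | [/\ smooth_on setT h, derive1n 2 h = h, h 0 = a
                           & derive1 h 0 = b]].

Definition ode4_solution (a b : R) : R -> R :=
  get [set h : R -> R | [/\ smooth_on setT h,
         forall t, derive1n 4 h t = omega4 * h t,
         h 0 = 0 /\ derive1 h 0 = 0 & derive1 h T = a /\ derive1n 2 h T = b]].

Section CurveFunctions.
Variables (u : R -> 'rV[R]_M) (q : R -> 'rV[R]_N) (beta : nat) (i : 'I_N).

Definition hh : R -> R :=
  ode2_solution (derive1n beta q 0 0 i)
    (- momentum r beta i (controlled (dtL D) u) (njet n q 0)).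

Definition hh' : R -> R :=
  ode4_solution (derive1n beta q T 0 i)
    (momentum r beta i
       (fun x => controlled (dtL D) u x + total_derivative (dtC D) x)
       (njet n q T)).

Definition hh'' : R -> R := ode4_solution (hh T) (derive1 hh T).

End CurveFunctions.

Section VariationFunctions.
Variable F : controlled_variation.

Definition us (s : R) : R -> 'rV[R]_M := fun t => var_u F (t, s).
Definition qs (s : R) : R -> 'rV[R]_N := fun t => var_F F (t, s).

Definition h_ s beta i : R -> R := hh (us s) (qs s) beta i.
Definition h'_ s beta i : R -> R := hh' (us s) (qs s) beta i.
Definition h''_ s beta i : R -> R := hh'' (us s) (qs s) beta i.

Definition mu (t s : R) : R :=
  - \int[lebesgue_measure]_(th in `[0, t])
      (dtL D (njet n (qs s) th, us s th) +
       2^-1 * \sum_(i < N) \sum_(beta < r)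
         ((derive1 (h_ s beta i) th) ^+ 2
          - (derive1n 2 (h'_ s beta i) th) ^+ 2
          - (derive1n 2 (h''_ s beta i) th) ^+ 2
          + (h_ s beta i th) ^+ 2
          + omega4 * (h'_ s beta i th) ^+ 2
          + omega4 * (h''_ s beta i th) ^+ 2)).

Definition mu' (t s : R) : R :=
  mu t s + \sum_(beta < r) \sum_(i < N)
    \int[lebesgue_measure]_(v in `[0, s])
      (derive1n 3 (h'_ v beta i) t * derive1 (fun s' => h'_ s' beta i t) v
       + derive1n 3 (h''_ v beta i) t * derive1 (fun s' => h''_ s' beta i t) v).

Definition d2mu' (t s : R) : R := derive1 (fun t' => derive1 (mu' t') s) t.

Definition variation_integral : R :=
  \int[lebesgue_measure]_(t in `[0, T])
    (\int[lebesgue_measure]_(s in `[0, 1])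
      (\sum_(a < M) derive1 (fun s' => us s' t 0 a) s *
                    'D_(delta_mx 0 a) (calP (njet n (qs s) t)) (us s t)
       - d2mu' t s)).

End VariationFunctions.

End MayerProblem.

(* Main.v *)
(** Write [q_b], [p_b] for the jet coordinates and momenta along a variation and
    [ds] for the derivative in its parameter.  For [0 < t < T], [0 < s < 1] the
    integrand is the [t]-derivative of
      [Phi = \sum (p_b ds q_b + h_(1) ds h - h'_(2) ds h'_(1) - h''_(2) ds h''_(1))]:
    the Euler-Lagrange equations turn [\sum dL/dq_b ds q_b] into
    [d/dt \sum p_b ds q_b], and the differential equations of [h], [h'], [h'']
    do the same with the quadratic terms of [mu'].  So the double integral is
    the integral over [s] of [Phi (T, s) - Phi (0, s)], where the boundary
    conditions on [h], [h'], [h''] cancel everything but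
    [- \sum p_b[dC/dt] ds q_b].  As [C] has order less than [r], the sums defining
    [p_b[dC/dt]] telescope to [dC/dq_b], so what is left is [- ds C].  Hence the
    double integral is the terminal cost at [s = 0] minus that at [s = 1], which
    gives both implications. *)

Require Import Defs.
From mathcomp Require Import all_boot all_order all_algebra.
From mathcomp Require Import all_classical all_reals all_analysis.
From mathcomp Require Import measurable_realfun ring lra.

Import Order.TTheory GRing.Theory Num.Theory.
Import numFieldNormedType.Exports.

Local Open Scope classical_set_scope.
Local Open Scope ring_scope.

Set Implicit Arguments.
Unset Strict Implicit.
Unset Printing Implicit Defensive.

(** * Smooth functions *)

Section SmoothCalculus.
Context {R : realType}.
Implicit Types V W : normedModType R.

(** At [t = 0] nothing fixes [p_b ds q_b], since the initial jet varies with [s]. The data of [h] at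
    [0] are chosen so that [h_(1) ds h] cancels it there; the price is the value of [h_(1) ds h] at
    [T], which [h''] removes, while [h'] removes [p_b ds q_b] at [T]. Both obey fourth order
    equations because they need two conditions at [0], to contribute nothing there, and two at [T].
    The correction that turns [mu] into [mu'] takes away [h'_(3) ds h'], whose value at [T] is not
    among the prescribed data; likewise for [h'']. Two obstacles shape the development. The
    functions [h], [h'], [h''] are selected separately for each [s], so their smoothness in [s] has
    to come from explicit solutions, linear in the boundary data. And the extended curves obey the
    Euler-Lagrange equations, with controls in [K], only over the closed rectangle [[0, T] x
    [0, 1]]: identities are first obtained at interior times or parameters, where they can be
    differentiated, and the boundary is reached by continuity or ignored as a null set. *)

Fixpoint Ck V W (k : nat) (A : set V) (f : V -> W) : Prop :=
  (forall x, A x -> differentiable f x) /\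
  if k is k'.+1 then forall v, Ck k' A (fun y => 'D_v f y) else True.

Lemma Ck_diff V W k (A : set V) (f : V -> W) :
  Ck k A f -> forall x, A x -> differentiable f x.
Proof. by case: k => [|k] []. Qed.

(** [Ck] peels off the innermost derivative, which in [smooth_on] is the last entry of the list of
    directions. This is the form in which sum, product and chain rules go through by induction on
    the order. *)
Lemma smooth_onP V W (A : set V) (f : V -> W) :
  smooth_on A f <-> forall k, Ck k A f.
Proof.
split=> [+ k|].
  elim: k f => [|k IH] f sf; first by split=> // x Ax; exact: (sf [::]).
  split=> [x Ax|v]; first exact: (sf [::]).
  by apply: IH => vs x Ax; have := sf (rcons vs v) x Ax; rewrite foldr_rcons.
move=> + vs; elim/last_ind: vs f => [|vs v IH] f Cf x Ax.
  exact: Ck_diff (Cf 0%N) _ Ax.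
rewrite foldr_rcons; apply: IH => // k.
by have [_] := Cf k.+1; exact.
Qed.

Lemma smooth_onS V W (A B : set V) (f : V -> W) :
  A `<=` B -> smooth_on B f -> smooth_on A f.
Proof. by move=> AB sf vs x /AB; exact: sf. Qed.

Lemma smooth_on_diff V W (A : set V) (f : V -> W) x :
  smooth_on A f -> A x -> differentiable f x.
Proof. by move=> sf; exact: (sf [::]). Qed.

Lemma smooth_on_cont V W (A : set V) (f : V -> W) x :
  smooth_on A f -> A x -> {for x, continuous f}.
Proof. by move=> sf Ax; exact/differentiable_continuous/(smooth_on_diff sf). Qed.

Lemma smooth_on_derivable V W (A : set V) (f : V -> W) x v :
  smooth_on A f -> A x -> derivable f x v.
Proof. by move=> sf Ax; exact/diff_derivable/(smooth_on_diff sf). Qed.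

Lemma smooth_on_derive V W (A : set V) (f : V -> W) v :
  smooth_on A f -> smooth_on A (fun y => 'D_v f y).
Proof. by move=> sf vs x Ax; have := sf (rcons vs v) x Ax; rewrite foldr_rcons. Qed.

Lemma open_near V (A : set V) (P : V -> Prop) x :
  open A -> A x -> (forall y, A y -> P y) -> \near x, P x.
Proof. by move=> oA Ax AP; near do apply: AP; exact: open_nbhs_nbhs.
Unshelve. all: by end_near. Qed.

Lemma eq_on_derive V W (A : set V) (f g : V -> W) v x : open A ->
  (forall y, A y -> f y = g y) -> A x -> 'D_v f x = 'D_v g x.
Proof. by move=> oA fg Ax; apply: near_eq_derive; exact: open_near fg. Qed.

(** The first order expansion of [f] at [x] serves for [g], since it only involves the germ;
    uniqueness of the differential then identifies the linear parts. *)
Lemma near_eq_differentiable V W (f g : V -> W) x :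
  (\near x, f x = g x) -> differentiable f x -> differentiable g x.
Proof.
move=> fg df.
have fgx : f x = g x by exact: nbhs_singleton fg.
have E : g \o shift x = cst (g x) + 'd f x +o_ 0 id.
  apply/eqaddoP => _/posnumP[e].
  have := diff_locally df => /eqaddoP /(_ e%:num (gt0 _)).
  have : \forall y \near 0, f (y + x) = g (y + x).
    by move: fg; rewrite (near_shift 0) subr0.
  apply: filter_app2; near=> y => E1 E2; move: E2.
  by rewrite !fctE /= -E1 fgx.
apply/diff_locallyP.
have dE : 'd g x = 'd f x :> (V -> W).
  by apply: diff_unique => //; exact: diff_continuous.
by rewrite dE; split => //; exact: diff_continuous.
Unshelve. all: by end_near. Qed.

Lemma Ck_pred V W k (A : set V) (f : V -> W) : Ck k.+1 A f -> Ck k A f.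
Proof.
elim: k f => [|k IH] f [df Df]; split => // v.
by apply: IH; exact: Df.
Qed.

Lemma Ck_eq V W k (A : set V) (f g : V -> W) : open A ->
  (forall x, A x -> f x = g x) -> Ck k A f -> Ck k A g.
Proof.
move=> oA; elim: k f g => [|k IH] f g fg /=.
  move=> [df _]; split => // x Ax; apply: near_eq_differentiable (df x Ax).
  exact: open_near fg.
move=> [df Df]; split => [x Ax|v].
  apply: near_eq_differentiable (df x Ax); exact: open_near fg.
by apply: IH (Df v) => x Ax; exact: eq_on_derive fg Ax.
Qed.

Lemma smooth_on_eq V W (A : set V) (f g : V -> W) : open A ->
  (forall x, A x -> f x = g x) -> smooth_on A f -> smooth_on A g.
Proof.
by move=> oA fg /smooth_onP Cf; apply/smooth_onP => k; exact: Ck_eq (Cf k).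
Qed.

Lemma smooth_on_cst V W (A : set V) (w : W) : smooth_on A (fun=> w).
Proof.
apply/smooth_onP => k.
elim: k w => [|k IH] w /=; first by split => // x _; exact: differentiable_cst.
split=> [x _|v]; first exact: differentiable_cst.
by under eq_fun do rewrite derive_cst; exact: IH.
Qed.

Lemma CkD V W k (A : set V) (f g : V -> W) : open A ->
  Ck k A f -> Ck k A g -> Ck k A (fun x => f x + g x).
Proof.
move=> oA; elim: k f g => [|k IH] f g Cf Cg /=.
  by split => // x Ax; exact: differentiableD (Ck_diff Cf Ax) (Ck_diff Cg Ax).
split => [x Ax|v].
  by exact: differentiableD (Ck_diff Cf Ax) (Ck_diff Cg Ax).
apply: Ck_eq (IH _ _ (Cf.2 v) (Cg.2 v)) => // x Ax.
by rewrite -deriveD//;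
  apply: diff_derivable; [exact: Ck_diff Cf _ Ax|exact: Ck_diff Cg _ Ax].
Qed.

Lemma CkM V k (A : set V) (f g : V -> R) : open A ->
  Ck k A f -> Ck k A g -> Ck k A (fun x => f x * g x).
Proof.
move=> oA; elim: k f g => [|k IH] f g Cf Cg /=.
  by split => // x Ax; exact: differentiableM (Ck_diff Cf Ax) (Ck_diff Cg Ax).
split => [x Ax|v].
  by exact: differentiableM (Ck_diff Cf Ax) (Ck_diff Cg Ax).
have C1 : Ck k A (fun x => f x * 'D_v g x) by apply: IH (Cg.2 v); exact: Ck_pred Cf.
have C2 : Ck k A (fun x => g x * 'D_v f x) by apply: IH (Cf.2 v); exact: Ck_pred Cg.
apply: Ck_eq (CkD oA C1 C2) => // x Ax.
by rewrite (@deriveM _ _ f g)//;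
  apply: diff_derivable; [exact: Ck_diff Cf _ Ax|exact: Ck_diff Cg _ Ax].
Qed.

Lemma smooth_onD V W (A : set V) (f g : V -> W) : open A ->
  smooth_on A f -> smooth_on A g -> smooth_on A (fun x => f x + g x).
Proof.
by move=> oA /smooth_onP Cf /smooth_onP Cg; apply/smooth_onP => k; exact: CkD.
Qed.

Lemma smooth_onM V (A : set V) (f g : V -> R) : open A ->
  smooth_on A f -> smooth_on A g -> smooth_on A (fun x => f x * g x).
Proof.
by move=> oA /smooth_onP Cf /smooth_onP Cg; apply/smooth_onP => k; exact: CkM.
Qed.

Lemma smooth_onMl V (A : set V) (c : R) (f : V -> R) : open A ->
  smooth_on A f -> smooth_on A (fun x => c * f x).
Proof. by move=> oA sf; apply: smooth_onM => //; exact: smooth_on_cst. Qed.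

Lemma smooth_onN V (A : set V) (f : V -> R) : open A ->
  smooth_on A f -> smooth_on A (fun x => - f x).
Proof.
move=> oA sf; rewrite (_ : (fun x => _) = fun x => -1 * f x); last first.
  by apply/funext => x; rewrite mulN1r.
exact: smooth_onMl.
Qed.

Lemma smooth_onB V (A : set V) (f g : V -> R) : open A ->
  smooth_on A f -> smooth_on A g -> smooth_on A (fun x => f x - g x).
Proof. by move=> oA sf sg; apply: smooth_onD => //; exact: smooth_onN. Qed.

Lemma smooth_on_sum V (A : set V) I (r : seq I) (P : pred I) (f : I -> V -> R) :
  open A -> (forall i, P i -> smooth_on A (f i)) ->
  smooth_on A (fun x => \sum_(i <- r | P i) f i x).
Proof.
move=> oA sf; elim: r => [|i r IH].
  by under eq_fun do rewrite big_nil; exact: smooth_on_cst.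
have [Pi|/negbTE Pi] := boolP (P i); last first.
  by apply: smooth_on_eq IH => // x _; rewrite big_cons Pi.
by apply: smooth_on_eq (smooth_onD oA (sf i Pi) IH) => // x _; rewrite big_cons Pi.
Qed.

Lemma derive_bigsum V (I : eqType) (r : seq I) (P : pred I) (f : I -> V -> R) x v :
  (forall i, i \in r -> P i -> derivable (f i) x v) ->
  is_derive x v (fun y => \sum_(i <- r | P i) f i y)
                (\sum_(i <- r | P i) 'D_v (f i) x).
Proof.
elim: r => [|i r IH] df.
  under eq_fun do rewrite big_nil; rewrite big_nil; exact: is_derive_cst.
have {}IH : is_derive x v (fun y => \sum_(i <- r | P i) f i y)
                (\sum_(i <- r | P i) 'D_v (f i) x).
  by apply: IH => j jr; apply: df; rewrite inE jr orbT.
have [Pi|/negbTE Pi] := boolP (P i); last first.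
  rewrite big_cons Pi (_ : (fun y => _) = (fun y => \sum_(i <- r | P i) f i y))//.
  by apply/funext => y; rewrite big_cons Pi.
rewrite big_cons Pi (_ : (fun y => _) = f i + (fun y => \sum_(i <- r | P i) f i y)).
  apply: is_deriveD => //; apply: derivableP; apply: df => //.
  by rewrite inE eqxx.
by apply/funext => y; rewrite big_cons Pi.
Qed.

Lemma is_derive_bigsum V (I : finType) (f : I -> V -> R) (df : I -> R) x v :
  (forall i, is_derive x v (f i) (df i)) ->
  is_derive x v (fun y => \sum_i f i y) (\sum_i df i).
Proof.
move=> dff; have E : \sum_i df i = \sum_i 'D_v (f i) x.
  by apply: eq_bigr => i _; have [_ ->] := dff i.
by rewrite E; apply: derive_bigsum => i _ _; have [] := dff i.
Qed.

(* Writing the inner map in coordinates makes its partial derivatives scalar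
   factors, so that the induction on the order needs no smoothness of
   vector-valued maps. *)
Lemma derive_comp_sum V W (I : finType) (c : I -> V -> R) (b : I -> W)
    (g : W -> R) x v :
  (forall i, differentiable (c i) x) ->
  differentiable g (\sum_i c i x *: b i) ->
  differentiable (fun y => g (\sum_i c i y *: b i)) x /\
  'D_v (fun y => g (\sum_i c i y *: b i)) x =
    \sum_i 'D_v (c i) x * 'D_(b i) g (\sum_i c i x *: b i).
Proof.
move=> dc dg.
pose f y := \sum_i c i y *: b i.
have [df Df] : differentiable f x /\ forall w, 'd f x w = \sum_i ('d (c i) x w) *: b i.
  rewrite /f; elim: (index_enum I) => [|i r [IHd IHD]].
    under eq_fun do rewrite big_nil.
    split=> [|w]; first exact: differentiable_cst.
    by rewrite big_nil diff_cst.
  under eq_fun do rewrite big_cons.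
  have di : differentiable (fun y => c i y *: b i) x by exact: differentiableZl.
  split=> [|w]; first exact: differentiableD.
  rewrite big_cons -IHD (diffD di IHd) /=; congr (_ + _).
  by rewrite diffZl.
split; first exact: (differentiable_comp df dg).
rewrite deriveE; last exact: (differentiable_comp df dg).
rewrite (diff_comp df dg) /= Df linear_sum; apply: eq_bigr => i _.
by rewrite linearZ deriveE// deriveE.
Qed.

(** A derivative of the composite is a sum of products of derivatives of the [c i] with composites
    of the same shape, ['D_(b i) g] replacing [g]. Hence the induction runs over all smooth [g] at
    once. *)
Lemma smooth_on_comp V W (A : set V) (B : set W) (I : finType) (c : I -> V -> R)
    (b : I -> W) (g : W -> R) : open A ->
  (forall i, smooth_on A (c i)) -> smooth_on B g ->
  (forall x, A x -> B (\sum_i c i x *: b i)) ->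
  smooth_on A (fun x => g (\sum_i c i x *: b i)).
Proof.
move=> oA sc sg AB; apply/smooth_onP => k; elim: k g sg => [|k IH] g sg.
all: have key x v (Ax : A x) := derive_comp_sum v
  (fun i => smooth_on_diff (sc i) Ax) (smooth_on_diff sg (AB _ Ax)).
  by split=> // x Ax; have [] := key x 0 Ax.
split=> [x Ax|v]; first by have [] := key x 0 Ax.
pose G i x := 'D_v (c i) x * 'D_(b i) g (\sum_i c i x *: b i).
have CG : Ck k A (fun x => \sum_i G i x).
  elim: (index_enum I) => [|i r IHr].
    under eq_fun do rewrite big_nil.
    by have /smooth_onP := @smooth_on_cst V R A 0.
  under eq_fun do rewrite big_cons; apply: CkD => //; apply: CkM => //.
    by have /smooth_onP := smooth_on_derive v (sc i).
  by apply: (IH (fun y => 'D_(b i) g y)); exact: smooth_on_derive.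
by apply: Ck_eq CG => // x Ax; have [_ ->] := key x v Ax.
Qed.

Lemma derive_coord V m n (A : set V) (f : V -> 'M[R]_(m, n)) i j v x :
  smooth_on A f -> A x -> 'D_v (fun y => f y i j) x = 'D_v f x i j.
Proof.
by move=> sf Ax; rewrite derive_mx ?mxE//; exact: smooth_on_derivable sf Ax.
Qed.

Lemma smooth_on_coord V m n (A : set V) (f : V -> 'M[R]_(m, n)) i j : open A ->
  smooth_on A f -> smooth_on A (fun y => f y i j).
Proof.
move=> oA sf; apply/smooth_onP => k.
elim: k f sf => [|k IH] f sf.
  split=> // x Ax; apply: (differentiable_comp (g := fun N : 'M[R]_(m, n) => N i j)).
    exact: smooth_on_diff sf Ax.
  exact: differentiable_coord.
split=> [x Ax|v].
  apply: (differentiable_comp (g := fun N : 'M[R]_(m, n) => N i j)).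
    exact: smooth_on_diff sf Ax.
  exact: differentiable_coord.
apply: Ck_eq (IH (fun y => 'D_v f y) _) => //.
  by move=> x Ax; rewrite (derive_coord _ _ _ sf).
exact: smooth_on_derive.
Qed.

Lemma smooth_on_linear V W (A : set V) (f : {linear V -> W}) :
  continuous f -> smooth_on A f.
Proof.
move=> cf; apply/smooth_onP => -[|k].
  by split=> // x _; exact: linear_differentiable.
split=> [x _|v]; first exact: linear_differentiable.
have -> : (fun y => 'D_v f y) = (fun=> f v).
  apply/funext => y; rewrite deriveE; last exact: linear_differentiable.
  by rewrite diff_lin.
by have /smooth_onP := @smooth_on_cst V W A (f v).
Qed.

End SmoothCalculus.

(** * Symmetry of second derivatives *)

Section Schwarz.
Context {R : realType} {V : normedModType R}.
Implicit Types (f : V -> R) (x v w : V).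

Lemma is_derive_line (W : normedModType R) (f : V -> W) x v (a : R) :
  derivable f (a *: v + x) v ->
  is_derive a 1 (fun b => f (b *: v + x)) ('D_v f (a *: v + x)).
Proof.
have E : (fun h : R => h^-1 *: (f ((h *: 1 + a) *: v + x) - f (a *: v + x)))
       = (fun h => h^-1 *: (f (h *: v + (a *: v + x)) - f (a *: v + x))).
  by apply/funext => h; rewrite scalerDl [h *: 1]mulr1 addrA.
by move=> df; split; [rewrite /derivable E|rewrite /derive E].
Qed.

(** The mean value theorem is applied twice: to the [w]-increment of [f] as a function of the
    [v]-displacement, then to ['D_v f] in direction [w]. The second difference is symmetric in [v]
    and [w], so it also equals the expression with the derivatives in the other order. *)
Lemma second_difference_mean_value (A : set V) f x v w (h : R) : 0 < h ->
  smooth_on A f ->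
  (forall a b, 0 <= a <= h -> 0 <= b <= h -> A (a *: v + (b *: w + x))) ->
  exists a b, [/\ 0 <= a <= h, 0 <= b <= h &
   f (h *: v + (h *: w + x)) - f (h *: v + x) - f (h *: w + x) + f x =
   h ^+ 2 * 'D_w (fun y => 'D_v f y) (a *: v + (b *: w + x))].
Proof.
move=> h0 sf hA.
have A0 a : 0 <= a <= h -> A (a *: v + x).
  by move=> ah; have := hA a 0 ah; rewrite scale0r add0r; apply; rewrite lexx ltW.
have hh : 0 <= h <= h by rewrite lexx ltW.
pose phi a := f (a *: v + (h *: w + x)) - f (a *: v + x).
pose dphi a := 'D_v f (a *: v + (h *: w + x)) - 'D_v f (a *: v + x).
have dP a : 0 <= a <= h -> is_derive a 1 phi (dphi a).
  move=> ah; apply: is_deriveB; apply: is_derive_line.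
    by apply: smooth_on_derivable sf _; exact: hA.
  by apply: smooth_on_derivable sf _; exact: A0.
have [] := @MVT _ phi dphi 0 h h0.
- by move=> a /[!in_itv]/= /andP[a0 ah]; apply: dP; rewrite !ltW.
- apply: derivable_within_continuous => a /[!in_itv]/= ah.
  by have [] := dP a ah.
move=> a /[!in_itv]/= /andP[a0 ah] E1.
have {a0 ah}ah : 0 <= a <= h by rewrite !ltW.
pose psi b := 'D_v f (b *: w + (a *: v + x)).
pose dpsi b := 'D_w (fun y => 'D_v f y) (b *: w + (a *: v + x)).
have dQ b : 0 <= b <= h -> is_derive b 1 psi (dpsi b).
  move=> bh; apply: (is_derive_line (f := fun y => 'D_v f y)).
  apply: smooth_on_derivable (smooth_on_derive v sf) _.
  by rewrite addrCA; exact: hA.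
have [] := @MVT _ psi dpsi 0 h h0.
- by move=> b /[!in_itv]/= /andP[b0 bh]; apply: dQ; rewrite !ltW.
- apply: derivable_within_continuous => b /[!in_itv]/= bh.
  by have [] := dQ b bh.
move=> b /[!in_itv]/= /andP[b0 bh] E2.
exists a, b; split=> //; first by rewrite !ltW.
rewrite -/psi in E2; rewrite [in RHS]addrCA -/(dpsi b) expr2 -mulrA.
move: E2; rewrite subr0 [dpsi b * h]mulrC => <-.
move: E1; rewrite /phi /dphi /psi !subr0 !scale0r !add0r.
by rewrite [_ *: w + (_ *: v + _)]addrCA => E1; rewrite mulrC -E1; ring.
Qed.

(** The points [y] and [z] are allowed to differ because the two orders of differentiation produce
    different mean value points. *)
Lemma eq_of_nearby_values (A : set V) (P S : V -> R) x : open A -> A x ->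
  {for x, continuous P} -> {for x, continuous S} ->
  (forall d, 0 < d -> ball x d `<=` A ->
     exists y z, [/\ ball x d y, ball x d z & P y = S z]) ->
  P x = S x.
Proof.
move=> oA Ax cP cS yz; apply/eqP/negPn/negP => ne.
have e0 : 0 < `|P x - S x| / 2 by rewrite divr_gt0// normr_gt0 subr_eq0.
move/cvgrPdist_lt : cP => /(_ _ e0) nP.
move/cvgrPdist_lt : cS => /(_ _ e0) nS.
have nA : nbhs x A by exact: open_nbhs_nbhs.
have /nbhs_ballP[d /= d0 dB] : nbhs x (fun y => [/\ A y,
    `|P x - P y| < `|P x - S x| / 2 & `|S x - S y| < `|P x - S x| / 2]).
  by move: nA nP nS; apply: filterS3 => y Ay Py Sy.
have [|y [z [By Bz E]]] := yz d d0; first by move=> y /dB[].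
have [_ Py _] := dB _ By; have [_ _ Sz] := dB _ Bz.
rewrite -E distrC in Sz.
have : `|P x - S x| < `|P x - S x| / 2 + `|P x - S x| / 2.
  apply: le_lt_trans (ltrD Py Sz).
  by apply: le_trans (ler_normD _ _); rewrite addrA subrK.
by rewrite -splitr ltxx.
Qed.

Lemma derive_commute (A : set V) f x v w : open A -> smooth_on A f -> A x ->
  'D_v (fun y => 'D_w f y) x = 'D_w (fun y => 'D_v f y) x.
Proof.
move=> oA sf Ax.
apply: (@eq_of_nearby_values A (fun y => 'D_v (fun y => 'D_w f y) y)
  (fun y => 'D_w (fun y => 'D_v f y) y) x oA Ax).
- by apply: smooth_on_cont Ax; do 2 apply: smooth_on_derive.
- by apply: smooth_on_cont Ax; do 2 apply: smooth_on_derive.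
move=> d d0 dA.
(* With [h * m = d / 2] the whole parallelogram spanned by [h *: v] and [h *: w] at [x] stays in the
   ball of radius [d]; the summand [1] keeps [m] positive when [v] and [w] vanish. *)
pose m := `|v| + `|w| + 1.
have m0 : 0 < m by rewrite ltr_wpDl.
pose h := d / 2 / m.
have h0 : 0 < h by rewrite !divr_gt0.
have inB a b : 0 <= a <= h -> 0 <= b <= h -> ball x d (a *: v + (b *: w + x)).
  move=> /andP[a0 ah] /andP[b0 bh]; rewrite -ball_normE/= distrC addrA addrK.
  rewrite (le_lt_trans (ler_normD _ _))// !normrZ !ger0_norm//.
  apply: (@le_lt_trans _ _ (h * m)).
    rewrite /m !mulrDr -[leLHS]addr0 lerD//; last by rewrite mulr1 ltW.
    by rewrite lerD// ler_wpM2r.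
  by rewrite /h divfK ?gt_eqF// ltr_pdivrMr// ltr_pMr// ltr1n.
have [|a [b [ah bh E1]]] := @second_difference_mean_value A f x v w h h0 sf.
  by move=> a b ah bh; apply: dA; exact: inB.
have [|b' [a' [bh' ah' E2]]] := @second_difference_mean_value A f x w v h h0 sf.
  by move=> b' a' bh' ah'; apply: dA; rewrite addrCA; exact: inB.
exists (b' *: w + (a' *: v + x)), (a *: v + (b *: w + x)); split.
- by rewrite addrCA; exact: inB.
- exact: inB.
apply: (@mulfI _ (h ^+ 2)); first by rewrite expf_neq0// gt_eqF.
apply: etrans (esym E2) _; apply: etrans _ E1.
rewrite [h *: w + (h *: v + x)]addrCA.
by congr (_ + _); exact: addrAC.
Qed.

End Schwarz.

(** * Rules for directional derivatives of smooth functions *)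

Section SmoothRules.
Context {R : realType} {V : normedModType R}.
Implicit Types (A : set V) (f g : V -> R).

Lemma smooth_deriveD A f g v x : smooth_on A f -> smooth_on A g -> A x ->
  'D_v (fun y => f y + g y) x = 'D_v f x + 'D_v g x.
Proof.
by move=> sf sg Ax; apply: deriveD;
  [exact: smooth_on_derivable sf Ax|exact: smooth_on_derivable sg Ax].
Qed.

Lemma smooth_deriveM A f g v x : smooth_on A f -> smooth_on A g -> A x ->
  'D_v (fun y => f y * g y) x = 'D_v f x * g x + f x * 'D_v g x.
Proof.
move=> sf sg Ax; rewrite (@deriveM _ _ f g); first by rewrite addrC [g x *: _]mulrC.
  exact: smooth_on_derivable sf Ax.
exact: smooth_on_derivable sg Ax.
Qed.

Lemma smooth_deriveMl A c f v x : smooth_on A f -> A x ->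
  'D_v (fun y => c * f y) x = c * 'D_v f x.
Proof.
move=> sf Ax; rewrite (smooth_deriveM v (smooth_on_cst c) sf Ax).
by rewrite derive_cst mul0r add0r.
Qed.

Lemma smooth_deriveN A f v x : smooth_on A f -> A x ->
  'D_v (fun y => - f y) x = - 'D_v f x.
Proof. by move=> sf Ax; apply: deriveN; exact: smooth_on_derivable sf Ax. Qed.

Lemma smooth_derive_sum A (I : eqType) (r : seq I) (P : pred I) (f : I -> V -> R) v x :
  (forall i, P i -> smooth_on A (f i)) -> A x ->
  'D_v (fun y => \sum_(i <- r | P i) f i y) x = \sum_(i <- r | P i) 'D_v (f i) x.
Proof.
move=> sf Ax; have [//|_ ->//] := @derive_bigsum _ _ _ r P f x v _.
by move=> i _ Pi; exact: smooth_on_derivable (sf i Pi) Ax.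
Qed.

Lemma derive_invariant f v x : (forall h : R, f (h *: v + x) = f x) -> 'D_v f x = 0.
Proof.
move=> fv; rewrite /derive (_ : (fun h => _) = fun=> 0); first exact: lim_cst.
by apply/funext => h /=; rewrite fv subrr scaler0.
Qed.

(** The two difference quotients are the same function of [h], so no differentiability is involved.
    It moves derivatives between the jet space, the control space and their product. *)
Lemma eq_derive_line (V' : normedModType R) (f : V -> R) (g : V' -> R) v w x y :
  (forall h : R, f (h *: v + x) = g (h *: w + y)) -> f x = g y ->
  'D_v f x = 'D_w g y.
Proof.
move=> fg fgx; rewrite /derive (_ : (fun h => _) =
  (fun h : R => h^-1 *: ((g \o shift y) (h *: w) - g y)))//.
by apply/funext => h /=; rewrite fg fgx.
Qed.

End SmoothRules.

(** * The differential equations of [h], [h'], [h''] *)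

Section LinearODE.
Context {R : realType}.
Implicit Types f g : R -> R.

Lemma is_deriveMc (c : R) f df (t : R) :
  is_derive t 1 f df -> is_derive t 1 (fun t => c * f t) (c * df).
Proof. by move=> h; exact: (is_deriveZ c). Qed.

Lemma is_deriveDf f g df dg (t : R) : is_derive t 1 f df -> is_derive t 1 g dg ->
  is_derive t 1 (fun t => f t + g t) (df + dg).
Proof. by move=> h h'; exact: is_deriveD. Qed.

Lemma is_deriveMf f g df dg (t : R) : is_derive t 1 f df -> is_derive t 1 g dg ->
  is_derive t 1 (fun t => f t * g t) (f t * dg + g t * df).
Proof. by move=> h h'; exact: is_deriveM. Qed.

(** Integrating factor: [f t * expR (- c * t)] has derivative zero. *)
Lemma first_order_uniqueness (c : R) f :
  (forall t : R, is_derive t 1 f (c * f t)) -> f 0 = 0 -> forall t, f t = 0.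
Proof.
move=> df f0 t.
have dE (s : R) : is_derive s 1 (fun s => expR (- c * s)) (- c * expR (- c * s)).
  rewrite mulrC; apply: (@is_derive1_comp _ expR (fun s => - c * s) s _ (- c)).
  exact: is_derive_eq (is_deriveMc (- c) (is_derive_id s 1)) (mulr1 _).
have : f t * expR (- c * t) = f 0 * expR (- c * 0).
  apply: (is_derive_0_is_cst (f := fun s => f s * expR (- c * s))) => s.
  apply: is_derive_eq (is_deriveMf (df s) (dE s)) _; ring.
by rewrite f0 mul0r => /eqP; rewrite mulf_eq0 (gt_eqF (expR_gt0 _)) orbF => /eqP.
Qed.

(** The factors of [D^2 - 1]: [f1 + f0] solves [y' = y] and [f1 - f0] solves [y' = - y], both with
    value [0] at [0]. *)
Lemma second_order_uniqueness f0 f1 :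
  (forall t : R, is_derive t 1 f0 (f1 t)) -> (forall t : R, is_derive t 1 f1 (f0 t)) ->
  f0 0 = 0 -> f1 0 = 0 -> forall t, f0 t = 0.
Proof.
move=> d0 d1 z0 z1 t.
have E1 : f1 t + 1 * f0 t = 0.
  apply: (@first_order_uniqueness 1 (fun t => f1 t + 1 * f0 t)); last by rewrite z0 z1; ring.
  move=> s; apply: is_derive_eq (is_deriveDf (d1 s) (is_deriveMc 1 (d0 s))) _; ring.
have E2 : f1 t + -1 * f0 t = 0.
  apply: (@first_order_uniqueness (-1) (fun t => f1 t + -1 * f0 t)); last by rewrite z0 z1; ring.
  move=> s; apply: is_derive_eq (is_deriveDf (d1 s) (is_deriveMc (-1) (d0 s))) _; ring.
lra.
Qed.

(* [D^4 - w^4 = (D - w)(D^3 + w D^2 + w^2 D + w^3)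
   = (D + w)(D^3 - w D^2 + w^2 D - w^3)]; the two cubic expressions vanish by
   first order uniqueness, so that [f'' = - w^2 f] and the energy
   [f'^2 + w^2 f^2] is constant. *)
Lemma fourth_order_uniqueness (w : R) f0 f1 f2 f3 : 0 < w ->
  (forall t : R, is_derive t 1 f0 (f1 t)) -> (forall t : R, is_derive t 1 f1 (f2 t)) ->
  (forall t : R, is_derive t 1 f2 (f3 t)) ->
  (forall t : R, is_derive t 1 f3 (w ^+ 4 * f0 t)) ->
  f0 0 = 0 -> f1 0 = 0 -> f2 0 = 0 -> f3 0 = 0 -> forall t, f0 t = 0.
Proof.
move=> w0 d0 d1 d2 d3 z0 z1 z2 z3.
have cubic (c : R) : c ^+ 4 = w ^+ 4 ->
    forall t, f3 t + (c * f2 t + (c ^+ 2 * f1 t + c ^+ 3 * f0 t)) = 0.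
  move=> cw; apply: (@first_order_uniqueness c
    (fun t => f3 t + (c * f2 t + (c ^+ 2 * f1 t + c ^+ 3 * f0 t))));
    last by rewrite z0 z1 z2 z3; ring.
  move=> s; apply: is_derive_eq (is_deriveDf (d3 s) (is_deriveDf
    (is_deriveMc c (d2 s)) (is_deriveDf (is_deriveMc (c ^+ 2) (d1 s))
    (is_deriveMc (c ^+ 3) (d0 s))))) _.
  by rewrite -cw; ring.
have f2E t : f2 t = - w ^+ 2 * f0 t.
  have E1 := cubic w erefl t; have E2 := cubic (- w) (ltac:(ring)) t.
  apply: (@mulfI _ (2 * w)); first by rewrite gt_eqF// mulr_gt0.
  apply/eqP; rewrite -subr_eq0 -(subrr 0) -{1}E1 -E2; apply/eqP; ring.
move=> t.
have : f1 t * f1 t + w ^+ 2 * (f0 t * f0 t) = f1 0 * f1 0 + w ^+ 2 * (f0 0 * f0 0).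
  apply: (is_derive_0_is_cst (f := fun s => f1 s * f1 s + w ^+ 2 * (f0 s * f0 s))) => s.
  apply: is_derive_eq (is_deriveDf (is_deriveMf (d1 s) (d1 s))
    (is_deriveMc (w ^+ 2) (is_deriveMf (d0 s) (d0 s)))) _.
  by rewrite f2E; ring.
rewrite z0 z1 !mul0r mulr0 addr0 -!expr2 => /eqP.
rewrite paddr_eq0 ?sqr_ge0//; last by apply: mulr_ge0; exact: sqr_ge0.
move=> /andP[_].
by rewrite mulf_eq0 !sqrf_eq0 (gt_eqF w0) => /eqP.
Qed.

Lemma CkS_antiderivative (c : R) f g k :
  (forall t : R, is_derive t 1 f (c * g t)) -> Ck k setT g -> Ck k.+1 setT f.
Proof.
move=> df Cg; split=> [t _|v]; first by apply/derivable1_diffP; have [] := df t.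
have -> : (fun t => 'D_v f t) = (fun t => (v * c) * g t).
  apply/funext => t; have [dt Dt] := df t.
  have dd := (derivable1_diffP f t).1 dt.
  rewrite deriveE// -[X in 'd f t X]mulr1 -[v * 1]/(v *: 1) linearZ/= -deriveE//.
  by rewrite Dt /GRing.scale/= mulrA.
apply: CkM => //; first exact: openT.
by have /smooth_onP := @smooth_on_cst R R R setT (v * c).
Qed.

(** Bootstrapping: each derivative is a multiple of the next member, so all members gain one order
    of differentiability together. *)
Lemma smooth_on_derivative_cycle (w : R) (f : nat -> R -> R) :
  (forall i (t : R), is_derive t 1 (f i) (w * f i.+1 t)) ->
  forall i, smooth_on setT (f i).
Proof.
move=> df i; apply/smooth_onP => k; elim: k i => [|k IH] i.
  by split=> // t _; apply/derivable1_diffP; have [] := df i t.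
exact: CkS_antiderivative (df i) (IH i.+1).
Qed.

Lemma derive1_fun (W : normedModType R) (f : R -> W) : derive1 f = fun t => 'D_1 f t.
Proof. by apply/funext => t; rewrite derive1E. Qed.

Lemma smooth_on_derive1n (A : set R) (W : normedModType R) (f : R -> W) k :
  smooth_on A f -> smooth_on A (derive1n k f).
Proof.
move=> sf; elim: k => // k IH; rewrite derive1nS derive1_fun.
exact: smooth_on_derive.
Qed.

Lemma is_derive_derive1n (A : set R) (W : normedModType R) (f : R -> W) k t :
  smooth_on A f -> A t -> is_derive t 1 (derive1n k f) (derive1n k.+1 f t).
Proof.
move=> sf At; rewrite derive1nS derive1E; apply: derivableP.
exact: smooth_on_derivable (smooth_on_derive1n k sf) At.
Qed.

Definition hypcos (w t : R) := 2^-1 * expR (w * t) + 2^-1 * expR (- w * t).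
Definition hypsin (w t : R) := 2^-1 * expR (w * t) + - 2^-1 * expR (- w * t).

Lemma is_derive_scaled f df (w t : R) : is_derive (w * t) 1 f df ->
  is_derive t 1 (fun t => f (w * t)) (w * df).
Proof.
move=> d; rewrite mulrC; apply: (@is_derive1_comp _ f (fun s => w * s) t _ w).
exact: is_derive_eq (is_deriveMc w (is_derive_id t 1)) (mulr1 _).
Qed.

Lemma is_derive_hypcos (w t : R) : is_derive t 1 (hypcos w) (w * hypsin w t).
Proof.
apply: is_derive_eq (is_deriveDf
  (is_deriveMc 2^-1 (is_derive_scaled (w := w) (is_derive_expR (w * t))))
  (is_deriveMc 2^-1 (is_derive_scaled (w := - w) (is_derive_expR (- w * t))))) _.
rewrite /hypsin; ring.
Qed.

Lemma is_derive_hypsin (w t : R) : is_derive t 1 (hypsin w) (w * hypcos w t).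
Proof.
apply: is_derive_eq (is_deriveDf
  (is_deriveMc 2^-1 (is_derive_scaled (w := w) (is_derive_expR (w * t))))
  (is_deriveMc (- 2^-1) (is_derive_scaled (w := - w) (is_derive_expR (- w * t))))) _.
rewrite /hypcos; ring.
Qed.

Lemma hypcos0 (w : R) : hypcos w 0 = 1.
Proof. rewrite /hypcos !mulr0 expR0; lra. Qed.

Lemma hypsin0 (w : R) : hypsin w 0 = 0.
Proof. rewrite /hypsin !mulr0 expR0; ring. Qed.

Lemma hypcos2B (w t : R) : hypcos w t ^+ 2 - hypsin w t ^+ 2 = 1.
Proof.
have e : expR (w * t) * expR (- w * t) = 1 by rewrite -expRD mulNr subrr expR0.
rewrite /hypcos /hypsin; set x := expR (w * t) in e *; set y := expR _ in e *.
by transitivity (x * y) => //; field.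
Qed.

Lemma hypsin_gt0 (w t : R) : 0 < w -> 0 < t -> 0 < hypsin w t.
Proof.
move=> w0 t0; rewrite /hypsin mulNr -mulrBr mulr_gt0// subr_gt0 ltr_expR.
by rewrite mulNr gtrN// mulr_gt0.
Qed.

Lemma ode2_solutionE : exists C S : R -> R,
  [/\ smooth_on setT C /\ smooth_on setT S,
      (forall t, derive1n 2 C t = C t) /\ (forall t, derive1n 2 S t = S t),
      C 0 = 1 /\ derive1 C 0 = 0, S 0 = 0 /\ derive1 S 0 = 1 &
      forall a b, ode2_solution a b = fun t => a * C t + b * S t].
Proof.
pose f i : R -> R := if odd i then hypsin 1 else hypcos 1.
have df i (t : R) : is_derive t 1 (f i) (1 * f i.+1 t).
  rewrite /f /=; case: (odd i) => /=; [exact: is_derive_hypsin|exact: is_derive_hypcos].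
have sf := smooth_on_derivative_cycle df.
have D1 i : derive1 (f i) = f i.+1.
  by apply/funext => t; rewrite derive1E; have [_ ->] := df i t; rewrite mul1r.
have sol a b : [set h : R -> R | [/\ smooth_on setT h, derive1n 2 h = h, h 0 = a
                           & derive1 h 0 = b]] (fun t => a * f 0 t + b * f 1 t).
  have dab i : derive1 (fun t => a * f i t + b * f i.+1 t) =
      (fun t => a * f i.+1 t + b * f i.+2 t).
    apply/funext => t; rewrite derive1E.
    have [_ ->] := is_deriveDf (is_deriveMc a (df i t)) (is_deriveMc b (df i.+1 t)).
    by rewrite !mul1r.
  split.
  - by apply: smooth_onD; [exact: openT| |]; apply: smooth_onMl => //; exact: openT.
  - by rewrite derive1nS derive1n1 !dab.
  - by rewrite /f /= hypcos0 hypsin0; ring.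
  - by rewrite dab /f /= hypcos0 hypsin0; ring.
exists (f 0), (f 1); split=> //.
- by split=> t; rewrite derive1nS derive1n1 !D1.
- by rewrite D1 /f /= hypcos0 hypsin0.
- by rewrite D1 /f /= hypcos0 hypsin0.
move=> a b; rewrite /ode2_solution.
have [sh h2 h0 h1] := getPex (ex_intro _ _ (sol a b)).
have [sg g2 g0 g1] := sol a b.
set h := get _ in sh h2 h0 h1 *; set g := (fun t => _) in sg g2 g0 g1 *.
have {}g0 : g 0 = a := g0.
apply/funext => t; apply/eqP; rewrite -subr_eq0 -mulN1r; apply/eqP.
apply: (@second_order_uniqueness (fun t => h t + -1 * g t)
                                 (fun t => derive1 h t + -1 * derive1 g t)) => [s|s||].
- have dh := is_derive_derive1n 0 sh (I : setT s).
  exact: is_deriveDf dh (is_deriveMc (-1) (is_derive_derive1n 0 sg (I : setT s))).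
- have dh := is_derive_derive1n 1 sh (I : setT s).
  have := is_deriveDf dh (is_deriveMc (-1) (is_derive_derive1n 1 sg (I : setT s))).
  by rewrite h2 g2.
- by rewrite h0 g0; ring.
- by rewrite h1 g1; ring.
Qed.

End LinearODE.

(** * The boundary value problem of fourth order *)

Section FourthOrder.
Context {R : realType}.

(* The [i]-th derivative of [cosh (w t) - cos (w t)] is [w ^ i] times the
   [i]-th member of this cycle of period 4. *)
Fixpoint hyptrig (w : R) (i : nat) : R -> R :=
  match i with
  | 0 => fun t => hypcos w t + -1 * cos (w * t)
  | 1 => fun t => hypsin w t + 1 * sin (w * t)
  | 2 => fun t => hypcos w t + 1 * cos (w * t)
  | 3 => fun t => hypsin w t + -1 * sin (w * t)
  | i'.+4 => hyptrig w i'
  end.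

Lemma is_derive_hyptrig (w t : R) i :
  is_derive t 1 (hyptrig w i) (w * hyptrig w i.+1 t).
Proof.
have dc := is_derive_scaled (w := w) (is_derive_cos (w * t)).
have ds := is_derive_scaled (w := w) (is_derive_sin (w * t)).
have dC := is_derive_hypcos w t; have dS := is_derive_hypsin w t.
elim/ltn_ind: i => -[|[|[|[|i]]]] IH; last by apply: (IH i); rewrite !ltnS leqW ?leqW.
- apply: is_derive_eq (is_deriveDf dC (is_deriveMc (-1) dc)) _.
  by rewrite /=; ring.
- apply: is_derive_eq (is_deriveDf dS (is_deriveMc 1 ds)) _.
  by rewrite /=; ring.
- apply: is_derive_eq (is_deriveDf dC (is_deriveMc 1 dc)) _.
  by rewrite /=; ring.
- apply: is_derive_eq (is_deriveDf dS (is_deriveMc (-1) ds)) _.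
  by rewrite /=; ring.
Qed.

Lemma hyptrig_at0 (w : R) : [/\ hyptrig w 0 0 = 0, hyptrig w 1 0 = 0,
  hyptrig w 2 0 = 2 & hyptrig w 3 0 = 0].
Proof.
by rewrite /= hypcos0 hypsin0 mulr0 cos0 sin0; split; ring.
Qed.

(** The determinant, up to a power of [w], of the map from coefficients to the data at [T]. Here the
    constant [pi / (2 T)] matters: at [w * T = pi / 2] the cosine vanishes and the sine is [1],
    leaving [(sinh + 1)^2 - cosh^2 = 2 sinh], which is positive. *)
Lemma hyptrig_det (w T : R) : w * T = pi / 2 -> 0 < w -> 0 < T ->
  hyptrig w 1 T * hyptrig w 1 T - hyptrig w 0 T * hyptrig w 2 T != 0.
Proof.
move=> wT w0 T0; rewrite /= wT cos_pihalf sin_pihalf.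
have E : hypcos w T ^+ 2 = 1 + hypsin w T ^+ 2.
  by rewrite -(hypcos2B w T) subrK.
have S := hypsin_gt0 w0 T0.
rewrite (_ : _ - _ = 2 * hypsin w T); first by rewrite gt_eqF// mulr_gt0.
by ring: E.
Qed.

Lemma ode4_solutionE (T : R) : 0 < T -> exists E1 E2 : R -> R,
  [/\ smooth_on setT E1 /\ smooth_on setT E2,
      (forall t, derive1n 4 E1 t = omega4 T * E1 t) /\
      (forall t, derive1n 4 E2 t = omega4 T * E2 t),
      [/\ E1 0 = 0, derive1 E1 0 = 0, E2 0 = 0 & derive1 E2 0 = 0],
      [/\ derive1 E1 T = 1, derive1n 2 E1 T = 0, derive1 E2 T = 0 & derive1n 2 E2 T = 1] &
      forall a b, ode4_solution T a b = fun t => a * E1 t + b * E2 t].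
Proof.
move=> T0; pose w : R := pi / (2 * T).
have w0 : 0 < w by rewrite divr_gt0 ?pi_gt0// mulr_gt0.
have wT : w * T = pi / 2 by rewrite /w; field; rewrite gt_eqF.
have det := hyptrig_det wT w0 T0.
set B := hyptrig w 1 T in det *; set A := hyptrig w 0 T in det *.
set C := hyptrig w 2 T in det *; set d := _ - _ in det.
pose f := hyptrig w.
have sf : forall i, smooth_on setT (f i).
  exact: smooth_on_derivative_cycle (fun i t => is_derive_hyptrig w t i).
(* The span of [cosh - cos] and [sinh - sin], the solutions whose value and first derivative vanish
   at [0]. *)
pose g (a b : R) t := a * f 0%N t + b * f 3 t.
have sg a b : smooth_on setT (g a b).
  by apply: smooth_onD; [exact: openT| |]; apply: smooth_onMl => //; exact: openT.
have gk a b k : derive1n k (g a b) = fun t => w ^+ k * (a * f k t + b * f k.+3 t).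
  elim: k => [|k IH]; first by apply/funext => t; rewrite derive1n0 expr0 mul1r.
  rewrite derive1nS IH; apply/funext => t; rewrite derive1E.
  have [_ ->] := is_deriveMc (w ^+ k) (is_deriveDf
    (is_deriveMc a (is_derive_hyptrig w t k))
    (is_deriveMc b (is_derive_hyptrig w t k.+3))).
  by rewrite exprS /f; ring.
have g4 a b t : derive1n 4 (g a b) t = omega4 T * g a b t.
  by rewrite gk.
have f4 i : f i.+4 = f i by [].
have [z0 z1 z2 z3] : [/\ f 0%N 0 = 0, f 1%N 0 = 0, f 2%N 0 = 2 & f 3%N 0 = 0].
  exact: hyptrig_at0.
have g00 a b : g a b 0 = 0 by rewrite /g z0 z3; ring.
have g10 a b : derive1n 1 (g a b) 0 = 0 by rewrite gk f4 z1 z0; ring.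
have g20 a b : derive1n 2 (g a b) 0 = 2 * w ^+ 2 * a by rewrite gk f4 z2 z1; ring.
have g30 a b : derive1n 3 (g a b) 0 = 2 * w ^+ 3 * b by rewrite gk f4 z2 z3; ring.
have g1T a b : derive1n 1 (g a b) T = w * (a * B + b * A).
  by rewrite gk expr1.
have g2T a b : derive1n 2 (g a b) T = w ^+ 2 * (a * C + b * B).
  by rewrite gk.
(* Cramer's rule for the two equations that [g1T] and [g2T] impose on the coefficients. *)
pose al a b : R := (w * a * B - b * A) / (w ^+ 2 * d).
pose be a b : R := (b * B - w * a * C) / (w ^+ 2 * d).
have wn0 : w != 0 by rewrite gt_eqF.
have abT a b : [/\ w * (al a b * B + be a b * A) = a &
                   w ^+ 2 * (al a b * C + be a b * B) = b].
  by split; rewrite /al /be /d; field; rewrite det wn0.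
have sol (a b : R) : [set h : R -> R | [/\ smooth_on setT h,
         forall t, derive1n 4 h t = omega4 T * h t,
         h 0 = 0 /\ derive1 h 0 = 0 & derive1 h T = a /\ derive1n 2 h T = b]]
    (g (al a b) (be a b)).
  have [E1 E2] := abT a b.
  split=> //; split.
  - exact: g00.
  - by rewrite -derive1n1 g10.
  - by rewrite -derive1n1 g1T.
  - by rewrite g2T.
(* Uniqueness passes through the initial value problem: [h] is compared with the member of the span
   having its second and third derivatives at [0], and the nonzero determinant then recovers these
   coefficients from the data at [T]. *)
have uniq (a b a' b' : R) (h : R -> R) : smooth_on setT h ->
    (forall t, derive1n 4 h t = omega4 T * h t) ->
    h 0 = 0 -> derive1 h 0 = 0 ->
    a' = derive1n 2 h 0 / (2 * w ^+ 2) -> b' = derive1n 3 h 0 / (2 * w ^+ 3) ->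
    derive1 h T = a -> derive1n 2 h T = b -> h = g (al a b) (be a b).
  move=> sh h4 h0 h1 a'E b'E h1T h2T.
  have hE : h = g a' b'.
    apply/funext => t; apply/eqP; rewrite -subr_eq0 -mulN1r; apply/eqP.
    pose D k t := derive1n k h t + -1 * derive1n k (g a' b') t.
    have dD k (s : R) : is_derive s 1 (D k) (D k.+1 s).
      exact: is_deriveDf (is_derive_derive1n k sh (I : setT s))
        (is_deriveMc (-1) (is_derive_derive1n k (sg a' b') (I : setT s))).
    apply: (@fourth_order_uniqueness _ w (D 0%N) (D 1%N) (D 2%N) (D 3%N)) => //.
    - by move=> s; apply: is_derive_eq (dD 3%N s) _; rewrite /D h4 g4 !derive1n0 /omega4 -/w; ring.
    - by rewrite /D !derive1n0 h0 g00; ring.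
    - by rewrite /D g10 derive1n1 h1; ring.
    - by rewrite /D g20 a'E; field.
    - by rewrite /D g30 b'E; field.
  have E1 : w * (a' * B + b' * A) = a by rewrite -g1T -hE.
  have E2 : w ^+ 2 * (a' * C + b' * B) = b by rewrite -g2T -hE.
  by rewrite hE; congr g; rewrite /al /be -E1 -E2 /d; field; rewrite det wn0.
exists (g (al 1 0) (be 1 0)), (g (al 0 1) (be 0 1)).
have [_ _ [x1 x2] [x3 x4]] := sol 1 0; have [_ _ [y1 y2] [y3 y4]] := sol 0 1.
split=> //.
move=> a b; rewrite /ode4_solution.
have [sh h4 [h0 h1] [h1T h2T]] := getPex (ex_intro _ _ (sol a b)).
set h := get _ in sh h4 h0 h1 h1T h2T *.
rewrite (uniq _ _ _ _ h sh h4 h0 h1 erefl erefl h1T h2T).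
by apply/funext => t; rewrite /g /al /be; field; rewrite wn0 det.
Qed.

End FourthOrder.

(** * Functions of [(t, s)] *)

Section Plane.
Context {R : realType}.
Implicit Types (W : normedModType R) (O : set (R * R)) (f g : R * R -> R).

Definition dt W (F : R * R -> W) (p : R * R) : W := 'D_((1, 0) : R * R) F p.
Definition ds W (F : R * R -> W) (p : R * R) : W := 'D_((0, 1) : R * R) F p.

Lemma smooth_on_dt W O (F : R * R -> W) : smooth_on O F -> smooth_on O (dt F).
Proof. exact: smooth_on_derive. Qed.

Lemma smooth_on_ds W O (F : R * R -> W) : smooth_on O F -> smooth_on O (ds F).
Proof. exact: smooth_on_derive. Qed.

Lemma smooth_on_iter_dt W O (F : R * R -> W) k :
  smooth_on O F -> smooth_on O (iter k (@dt W) F).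
Proof. by move=> sF; elim: k => //= k; exact: smooth_on_dt. Qed.

Lemma slice_t_quotient W (F : R * R -> W) (t s : R) :
  (fun h : R => h^-1 *: (F (h *: 1 + t, s) - F (t, s))) =
  (fun h : R => h^-1 *: (F (h *: ((1, 0) : R * R) + (t, s)) - F (t, s))).
Proof.
apply/funext => h; congr (_ *: (F _ - _)).
by apply/pair_equal_spec; split => //=; rewrite scaler0 add0r.
Qed.

Lemma slice_s_quotient W (F : R * R -> W) (t s : R) :
  (fun h : R => h^-1 *: (F (t, h *: 1 + s) - F (t, s))) =
  (fun h : R => h^-1 *: (F (h *: ((0, 1) : R * R) + (t, s)) - F (t, s))).
Proof.
apply/funext => h; congr (_ *: (F _ - _)).
by apply/pair_equal_spec; split => //=; rewrite scaler0 add0r.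
Qed.

Lemma derive_slice_t W (F : R * R -> W) t s :
  'D_1 (fun t => F (t, s)) t = dt F (t, s).
Proof. by rewrite /dt /derive -slice_t_quotient. Qed.

Lemma derive_slice_s W (F : R * R -> W) t s :
  'D_1 (fun s => F (t, s)) s = ds F (t, s).
Proof. by rewrite /ds /derive -slice_s_quotient. Qed.

Lemma is_derive_slice_t W O (F : R * R -> W) t s : smooth_on O F -> O (t, s) ->
  is_derive t 1 (fun t => F (t, s)) (dt F (t, s)).
Proof.
move=> sF Ots; split; last exact: derive_slice_t.
rewrite /derivable slice_t_quotient; exact: smooth_on_derivable sF Ots.
Qed.

Lemma is_derive_slice_s W O (F : R * R -> W) t s : smooth_on O F -> O (t, s) ->
  is_derive s 1 (fun s => F (t, s)) (ds F (t, s)).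
Proof.
move=> sF Ots; split; last exact: derive_slice_s.
rewrite /derivable slice_s_quotient; exact: smooth_on_derivable sF Ots.
Qed.

Lemma derive1_slice_t W (F : R * R -> W) t s :
  derive1 (fun t => F (t, s)) t = dt F (t, s).
Proof. by rewrite derive1E derive_slice_t. Qed.

Lemma derive1_slice_s W (F : R * R -> W) t s :
  derive1 (fun s => F (t, s)) s = ds F (t, s).
Proof. by rewrite derive1E derive_slice_s. Qed.

Lemma derive1n_slice_t W (F : R * R -> W) k s :
  derive1n k (fun t => F (t, s)) = fun t => iter k (@dt W) F (t, s).
Proof.
elim: k => // k IH; rewrite derive1nS IH; apply/funext => t.
exact: derive1_slice_t.
Qed.

Lemma ds_dt O f p : open O -> smooth_on O f -> O p -> ds (dt f) p = dt (ds f) p.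
Proof. exact: derive_commute. Qed.

Lemma eq_on_dt W O (F G : R * R -> W) : open O -> (forall p, O p -> F p = G p) ->
  forall p, O p -> dt F p = dt G p.
Proof. by move=> oO FG p; exact: eq_on_derive FG. Qed.

Lemma dtM O f g p : smooth_on O f -> smooth_on O g -> O p ->
  dt (fun p => f p * g p) p = dt f p * g p + f p * dt g p.
Proof. exact: smooth_deriveM. Qed.

Lemma dsM O f g p : smooth_on O f -> smooth_on O g -> O p ->
  ds (fun p => f p * g p) p = ds f p * g p + f p * ds g p.
Proof. exact: smooth_deriveM. Qed.

Lemma smooth_on_lift_t O (phi : R -> R) : open O -> smooth_on setT phi ->
  smooth_on O (fun p => phi p.1).
Proof.
move=> oO sphi.
have sfst (i : unit) : smooth_on O (fst : R * R -> R).
  apply: (@smooth_on_linear R (R * R)%type R O (fst : {linear (R * R)%type -> R})) => x.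
  exact: cvg_fst.
have := smooth_on_comp (B := setT) (b := fun=> 1 : R) oO sfst sphi (fun _ _ => I).
apply: smooth_on_eq => // p _.
by rewrite big_const card_unit /= addr0 [_ *: _]mulr1.
Qed.

Lemma smooth_on_freeze_t O f t0 : open O -> smooth_on O f ->
  (forall p, O p -> O (t0, p.2)) -> smooth_on O (fun p => f (t0, p.2)).
Proof.
move=> oO sf Ot0; pose c (i : bool) (p : R * R) : R := if i then p.2 else t0.
pose b (i : bool) : R * R := if i then (0, 1) else (1, 0).
have E p : (t0, p.2) = \sum_i c i p *: b i.
  rewrite big_bool /=; apply/pair_equal_spec; split => /=.
    by rewrite scaler0 add0r [_ *: _]mulr1.
  by rewrite scaler0 addr0 [_ *: _]mulr1.
apply: (@smooth_on_eq _ _ _ O (fun p => f (\sum_i c i p *: b i)) _ oO).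
  by move=> p _; rewrite -E.
apply: (smooth_on_comp oO _ sf) => [[]|p Op] /=; last by rewrite -E; exact: Ot0.
  apply: (@smooth_on_linear R (R * R)%type R O (snd : {linear (R * R)%type -> R})) => x.
  exact: cvg_snd.
exact: smooth_on_cst.
Qed.

Lemma continuous_eq_at_left (W : normedModType R) (k h : R -> W) a b : a < b ->
  {for a, continuous k} -> {for a, continuous h} ->
  (forall t, a < t < b -> k t = h t) -> k a = h a.
Proof.
move=> ab ck ch kh.
have E : k x @[x --> a^'+] --> h a.
  apply: cvg_trans (cvg_at_right_filter ch); apply: near_eq_cvg.
  by near=> t; rewrite kh//; apply/andP; split.
exact: (cvg_unique _ (cvg_at_right_filter ck) E).
Unshelve. all: by end_near. Qed.

Lemma continuous_eq_at_right (W : normedModType R) (k h : R -> W) a b : a < b ->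
  {for b, continuous k} -> {for b, continuous h} ->
  (forall t, a < t < b -> k t = h t) -> k b = h b.
Proof.
move=> ab ck ch kh.
have E : k x @[x --> b^'-] --> h b.
  apply: cvg_trans (cvg_at_left_filter ch); apply: near_eq_cvg.
  by near=> t; rewrite kh//; apply/andP; split.
exact: (cvg_unique _ (cvg_at_left_filter ck) E).
Unshelve. all: by end_near. Qed.

Lemma continuous_eq_closed (W : normedModType R) (k h : R -> W) a b : a < b ->
  (forall t, a <= t <= b -> {for t, continuous k}) ->
  (forall t, a <= t <= b -> {for t, continuous h}) ->
  (forall t, a < t < b -> k t = h t) -> forall t, a <= t <= b -> k t = h t.
Proof.
move=> ab ck ch kh t /andP[]; rewrite le_eqVlt => /predU1P[<- _|at_].
  by apply: (continuous_eq_at_left ab) => //; [apply: ck|apply: ch]; rewrite lexx ltW.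
rewrite le_eqVlt => /predU1P[->|tb]; last by apply: kh; rewrite at_.
by apply: (continuous_eq_at_right ab) => //; [apply: ck|apply: ch]; rewrite lexx ltW.
Qed.

(** At an interior point the germs of the two functions agree. At [a] and [b], outside of which they
    may differ, equality of the derivatives is a limit from the interior. *)
Lemma eq_derive1n_closed (W : normedModType R) (k h : R -> W) a b n : a < b ->
  smooth_on setT k -> smooth_on setT h ->
  (forall t, a <= t <= b -> k t = h t) ->
  forall t, a <= t <= b -> derive1n n k t = derive1n n h t.
Proof.
move=> ab sk sh kh; elim: n => // n IH; rewrite !derive1nS.
apply: continuous_eq_closed => // t tab.
- by have := smooth_on_derive1n n.+1 sk; move/smooth_on_cont; apply.
- by have := smooth_on_derive1n n.+1 sh; move/smooth_on_cont; apply.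
rewrite !derive1E; apply: near_eq_derive.
have : nbhs t `]a, b[%classic by apply: open_nbhs_nbhs; split => //; exact: interval_open.
apply: filterS => x; rewrite /= in_itv/= => /andP[h1 h2].
by apply: IH; rewrite !ltW.
Qed.

End Plane.

(** * Functions with separated variables *)

Section Separated.
Context {R : realType}.
Implicit Types (O : set (R * R)) (al be phi psi : R -> R).

(** The shape that [h], [h'] and [h''] take along a variation: boundary data depending on [s] times
    fixed fundamental solutions in [t]. *)
Definition separated al phi be psi (p : R * R) := al p.2 * phi p.1 + be p.2 * psi p.1.

Lemma iter_dt_separated k al phi be psi : smooth_on setT phi -> smooth_on setT psi ->
  iter k (@dt R R) (separated al phi be psi) =
  separated al (derive1n k phi) be (derive1n k psi).
Proof.
move=> sphi spsi; elim: k => // k IH; rewrite iterS IH.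
apply/funext => -[t s]; rewrite -derive1_slice_t derive1E.
have [_ ->//] : is_derive t 1
    (fun t => separated al (derive1n k phi) be (derive1n k psi) (t, s))
    (separated al (derive1n k.+1 phi) be (derive1n k.+1 psi) (t, s)).
exact: (is_deriveDf (is_deriveMc (al s) (is_derive_derive1n k sphi (I : setT t)))
                    (is_deriveMc (be s) (is_derive_derive1n k spsi (I : setT t)))).
Qed.

Lemma smooth_on_separated O al phi be psi : open O ->
  smooth_on O (fun p => al p.2) -> smooth_on O (fun p => be p.2) ->
  smooth_on setT phi -> smooth_on setT psi -> smooth_on O (separated al phi be psi).
Proof.
move=> oO sal sbe sphi spsi; apply: smooth_onD => //.
  by apply: smooth_onM => //; exact: smooth_on_lift_t.
by apply: smooth_onM => //; exact: smooth_on_lift_t.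
Qed.

End Separated.

(** * Integrals depending on a parameter *)

Section IntegralsOnRectangles.
Context {R : realType}.
Local Notation mu := (@lebesgue_measure R).
Implicit Types (k : R -> R) (f g : R * R -> R) (a b u v : R).

Lemma within_itv_cont k a b : (forall t, a <= t <= b -> {for t, continuous k}) ->
  {within `[a, b], continuous k}.
Proof.
by move=> ck; apply: continuous_in_subspaceT => t; rewrite inE/= in_itv/=; exact: ck.
Qed.

Lemma integrable_itv_cont k a b :
  (forall t, a <= t <= b -> {for t, continuous k}) ->
  mu.-integrable `[a, b] (EFin \o k).
Proof.
move=> ck; apply: continuous_compact_integrable; first exact: segment_compact.
exact: within_itv_cont.
Qed.

(** The endpoints form a null set, and [k] inherits measurability on the open interval from [h].
    This lets integrands be computed at interior points only, where their derivatives are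
    accessible. *)
Lemma eq_Rintegral_interior k (h : R -> R) a b :
  {within `[a, b], continuous h} ->
  (forall t, a < t < b -> k t = h t) ->
  \int[mu]_(t in `[a, b]) k t = \int[mu]_(t in `[a, b]) h t.
Proof.
move=> ch kh; rewrite /Rintegral; congr fine.
have mh : measurable_fun (`]a, b[%classic : set R) h.
  have /(measurable_int mu)/measurable_EFinP : mu.-integrable `[a, b] (EFin \o h).
    by apply: continuous_compact_integrable ch; exact: segment_compact.
  by apply: measurable_funS => //; exact: subset_itv_oo_cc.
apply: eq_integral_itv_bounded => //.
  by apply: eq_measurable_fun mh => t; rewrite inE/= in_itv/= => /kh.
Qed.

Lemma cont_slice f x y : {for (x, y), continuous f} ->
  {for y, continuous (fun y => f (x, y))}.
Proof.
move=> cf; have cp : (x, z) @[z --> y] --> (x, y).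
  by apply: (@cvg_pair _ _ _ (nbhs y) (nbhs x) (nbhs y)); [exact: cvg_cst|exact: cvg_id].
exact: (cvg_comp _ _ cp cf).
Qed.

Lemma cont_slice_l f x y : {for (x, y), continuous f} ->
  {for x, continuous (fun x => f (x, y))}.
Proof.
move=> cf; have cp : (z, y) @[z --> x] --> (x, y).
  by apply: (@cvg_pair _ _ _ (nbhs x) (nbhs x) (nbhs y)); [exact: cvg_id|exact: cvg_cst].
exact: (cvg_comp _ _ cp cf).
Qed.

Lemma cont_swap f x y : {for (y, x), continuous f} ->
  {for (x, y), continuous (fun p => f (p.2, p.1))}.
Proof.
move=> cf.
have c1 : continuous (fst : R * R -> R) by move=> p; exact: cvg_fst.
have c2 : continuous (snd : R * R -> R) by move=> p; exact: cvg_snd.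
have cp : (p.2, p.1) @[p --> (x, y)] --> (y, x).
  exact: (@cvg_pair _ _ _ (nbhs (x, y)) (nbhs y) (nbhs x) _ _ _ _ _ (c2 (x, y)) (c1 (x, y))).
exact: (cvg_comp _ _ cp cf).
Qed.

Lemma rectangle_bounded g a b u v :
  (forall x y, u <= x <= v -> a <= y <= b -> {for (x, y), continuous g}) ->
  exists M : R, forall x y, u <= x <= v -> a <= y <= b -> `|g (x, y)| <= M.
Proof.
move=> cg; pose A := (`[u, v]%classic `*` `[a, b]%classic) : set (R * R).
have cA : compact A by apply: compact_setX; exact: segment_compact.
have cgA : {within A, continuous g}.
  apply: continuous_in_subspaceT => -[x y]; rewrite inE => -[/=].
  by rewrite !in_itv/=; exact: cg.
have /compact_bounded : compact (g @` A) by exact: continuous_compact.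
move=> [M [_ HM]].
have gM : forall z, (g @` A) z -> `|z| <= M + 1.
  by move=> z Az; apply: (HM (M + 1)) => //; rewrite ltrDl.
exists (M + 1) => x y xuv yab.
by apply: (gM (g (x, y))); exists (x, y).
Qed.

Lemma is_derive_Rintegral f g a b u v x0 : u < x0 < v ->
  (forall x y, u < x < v -> a <= y <= b ->
     is_derive x 1 (fun x => f (x, y)) (g (x, y))) ->
  (forall x y, u < x < v -> a <= y <= b -> {for (x, y), continuous f}) ->
  (forall x y, u < x < v -> a <= y <= b -> {for (x, y), continuous g}) ->
  is_derive x0 1 (fun x => \int[mu]_(y in `[a, b]) f (x, y))
                 (\int[mu]_(y in `[a, b]) g (x0, y)).
Proof.
move=> /andP[ux xv] df cf cg.
(* On a compact subinterval around [x0] the derivative [g] is bounded, which provides a constant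
   dominating function. *)
pose u' := (u + x0) / 2; pose v' := (x0 + v) / 2.
have [uu' u'x xv' v'v] : [/\ u < u', u' < x0, x0 < v' & v' < v].
  by rewrite /u' /v'; split; lra.
have sub x : u' <= x <= v' -> u < x < v.
  by move=> /andP[h1 h2]; rewrite (lt_le_trans uu')//= (le_lt_trans h2).
have [M gM] : exists M : R, forall x y, u' <= x <= v' -> a <= y <= b -> `|g (x, y)| <= M.
  by apply: rectangle_bounded => x y xuv; apply: cg; exact: sub.
have Ix : (`]u', v'[%classic : set R) x0 by rewrite /= in_itv/= u'x.
pose F x y := f (x, y).
have intf x : (`]u', v'[%classic : set R) x -> mu.-integrable `[a, b] (EFin \o F x).
  rewrite /= in_itv/= => /andP[h1 h2]; apply: integrable_itv_cont => y yab.
  by apply: cont_slice; apply: cf => //; apply: sub; rewrite !ltW.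
have derf x y : (`]u', v'[%classic : set R) x -> (`[a, b]%classic : set R) y ->
    is_derive x 1 (F ^~ y) (g (x, y)).
  rewrite /= !in_itv/= => /andP[h1 h2] yab.
  by apply: df => //; apply: sub; rewrite !ltW.
have derf1 x y : (`]u', v'[%classic : set R) x -> (`[a, b]%classic : set R) y ->
    derivable (F ^~ y) x 1.
  by move=> xI yB; have [] := derf x y xI yB.
have dF x y : (`]u', v'[%classic : set R) x -> (`[a, b]%classic : set R) y ->
    partial1of2 F x y = g (x, y).
  by move=> xI yB; rewrite partial1of2E; have [_] := derf x y xI yB.
have G0 : forall y : R, 0 <= (fun=> `|M|) y by [].
have intG : mu.-integrable `[a, b] (EFin \o (fun=> `|M|)).
  by apply: integrable_itv_cont => y _; exact: cvg_cst.
have Gub x y : (`]u', v'[%classic : set R) x -> (`[a, b]%classic : set R) y ->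
    `|partial1of2 F x y| <= (fun=> `|M|) y.
  move=> xI yB; rewrite dF//; move: xI yB; rewrite /= !in_itv/= => /andP[h1 h2] yab.
  by apply: le_trans (ler_norm M); apply: gM => //; rewrite !ltW.
have D := derivable_under_integral (mu := mu) (measurable_itv _) Ix intf derf1 G0 intG Gub.
have E := differentiation_under_integral (mu := mu) (measurable_itv _) Ix intf derf1 G0 intG Gub.
split; first exact: D.
rewrite -derive1E E; apply: eq_Rintegral => y; rewrite inE => yB.
exact: dF.
Qed.

Lemma cont_Rintegral g a b u v :
  (forall x y, u <= x <= v -> a <= y <= b -> {for (x, y), continuous g}) ->
  {within `[u, v], continuous (fun x => \int[mu]_(y in `[a, b]) g (x, y))}.
Proof.
move=> cg.
have [vu|uv] := ltP v u.
  by rewrite set_itv_ge ?bnd_simp -?ltNge//; exact: continuous_subspace0.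
(* Clamping the parameter to [[u, v]] extends the integrand continuously and with the same bound to
   an open interval of parameters, where dominated continuity applies; on [[u, v]] nothing
   changes. *)
pose cl (x : R) : R := Num.max u (Num.min x v).
have clI x : u <= cl x <= v by rewrite /cl le_max lexx ge_max uv ge_min lexx orbT.
have clE x : u <= x <= v -> cl x = x.
  by move=> /andP[h1 h2]; rewrite /cl min_l// max_r.
have ccl : continuous cl.
  move=> x; apply: (@continuous_max _ _ (fun=> u) (fun x => Num.min x v)); first exact: cvg_cst.
  by apply: (@continuous_min _ _ id (fun=> v)); [exact: cvg_id|exact: cvg_cst].
have [M gM] := rectangle_bounded cg.
pose G x y := g (cl x, y).
have intf x : (`]u - 1, v + 1[%classic : set R) x -> mu.-integrable `[a, b] (EFin \o G x).
  by move=> _; apply: integrable_itv_cont => y yab; apply: cont_slice; exact: cg.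
have cG : {ae mu, forall y, (`[a, b]%classic : set R) y ->
    {in (`]u - 1, v + 1[%classic : set R), continuous (G ^~ y)}}.
  apply: aeW => y /=; rewrite in_itv/= => yab x _.
  exact: (continuous_comp (ccl x) (cont_slice_l (cg _ _ (clI x) yab))).
have intM : mu.-integrable `[a, b] (EFin \o (fun=> M)).
  by apply: integrable_itv_cont => y _; exact: cvg_cst.
have ub x : (`]u - 1, v + 1[%classic : set R) x ->
    {ae mu, forall y, (`[a, b]%classic : set R) y -> `|G x y| <= (fun=> M) y}.
  by move=> _; apply: aeW => y /=; rewrite in_itv/= => yab; exact: gM.
have H := continuity_under_integral (mu := mu) (measurable_itv _) intf cG intM ub.
have : {within `[u, v], continuous (fun x => \int[mu]_(y in `[a, b]) G x y)}.
  apply: within_itv_cont => x /andP[h1 h2]; apply: H.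
  by rewrite inE/= in_itv/=; apply/andP; split; lra.
apply: subspace_eq_continuous => x; rewrite inE/= in_itv/= => xuv.
by apply: eq_Rintegral => y _; rewrite /G clE.
Qed.

Lemma is_derive_Rintegral_upper k a b t :
  (forall t, a <= t <= b -> {for t, continuous k}) -> a < t < b ->
  is_derive t 1 (fun t => \int[mu]_(th in `[a, t]) k th) (k t).
Proof.
move=> ck /andP[at_ tb].
have [D E] := continuous_FTC1_closed tb (integrable_itv_cont ck) at_
  (ck t (introT andP (conj (ltW at_) (ltW tb)))).
by split; [exact: D|rewrite -derive1E; exact: E].
Qed.

Lemma Rintegral_derive k dk a b : a < b ->
  {within `[a, b], continuous k} -> {within `[a, b], continuous dk} ->
  (forall t, a < t < b -> is_derive t 1 k (dk t)) ->
  \int[mu]_(t in `[a, b]) dk t = k b - k a.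
Proof.
move=> ab ck cdk dkk; rewrite /Rintegral (@continuous_FTC2 _ dk k a b)//.
- move/(continuous_within_itvP _ ab) : ck => [_ ka kb]; split=> // t.
  by rewrite in_itv/= => /dkk[].
- by move=> t; rewrite in_itv/= => /dkk[_ <-]; rewrite derive1E.
Qed.

(* Fubini for [\int\int d/dx f], through differentiation of the inner
   integral. *)
Lemma Rintegral_rectangle_derive f g a b u v : u < v ->
  (forall x y, u <= x <= v -> a <= y <= b -> {for (x, y), continuous f}) ->
  (forall x y, u <= x <= v -> a <= y <= b -> {for (x, y), continuous g}) ->
  (forall x y, u < x < v -> a <= y <= b ->
     is_derive x 1 (fun x => f (x, y)) (g (x, y))) ->
  \int[mu]_(x in `[u, v]) \int[mu]_(y in `[a, b]) g (x, y) =
  \int[mu]_(y in `[a, b]) (f (v, y) - f (u, y)).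
Proof.
move=> uv cf cg df.
have uvW x : u < x < v -> u <= x <= v by move=> /andP[? ?]; rewrite !ltW.
have if_ x : u <= x <= v -> mu.-integrable `[a, b] (EFin \o (fun y => f (x, y))).
  move=> xuv; apply: integrable_itv_cont => y yab.
  by apply: cont_slice; exact: cf.
rewrite RintegralB; [|exact: measurable_itv|by apply: if_; rewrite lexx ltW..].
apply: (@Rintegral_derive (fun x => \int[mu]_(y in `[a, b]) f (x, y))
  (fun x => \int[mu]_(y in `[a, b]) g (x, y)) u v uv).
- exact: cont_Rintegral.
- exact: cont_Rintegral.
- move=> x xuv; apply: (@is_derive_Rintegral f g a b u v) => // x' y x'uv.
  + by apply: cf; exact: uvW.
  + by apply: cg; exact: uvW.
Qed.

End IntegralsOnRectangles.

(** * Jets *)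

Section JetCalculus.
Context {R : realType} {N n : nat}.
Local Notation J := (jet R N n).
Implicit Types (A : set J) (f g : J -> R) (Q : set 'rV[R]_N).

Lemma open_Jn Q : open Q -> open (Jn (n := n) Q).
Proof.
move=> oQ; have c : continuous (fun x : J => row ord0 x.2).
  move=> x; apply: (@cvg_comp _ _ _ snd (fun A : 'M[R]_(n.+1, N) => row ord0 A)).
    exact: cvg_snd.
  apply/cvgrPdist_le => e e0.
  have /cvgrPdist_le/(_ e e0) := @cvg_id _ (nbhs x.2).
  apply: filterS => A; apply: le_trans.
  rewrite -linearB /= [leLHS]/Num.Def.normr/= mx_normrE.
  apply: bigmax_le => // -[i j] _ /=; rewrite mxE.
  by rewrite [leRHS]/Num.Def.normr/= mx_normrE; exact: (le_bigmax _ _ (ord0, j)).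
exact: (open_comp (fun x _ => c x) oQ).
Qed.

Lemma smooth_on_jet_coord A k j : open A -> smooth_on A (fun x : J => x.2 k j).
Proof.
move=> oA; apply: (@smooth_on_coord _ _ _ _ A snd) => //.
apply: (@smooth_on_linear R J _ A (snd : {linear J -> 'M[R]_(n.+1, N)})) => x.
exact: cvg_snd.
Qed.

Lemma derive_jet_coord k j (v x : J) : 'D_v (fun x : J => x.2 k j) x = v.2 k j.
Proof.
rewrite (@derive_coord _ _ _ _ setT snd) //; last first.
  apply: (@smooth_on_linear R J _ _ (snd : {linear J -> 'M[R]_(n.+1, N)})) => y.
  exact: cvg_snd.
rewrite deriveE ?diff_lin//=; first by move=> y; exact: cvg_snd.
by apply: (@linear_differentiable _ _ _ (snd : {linear J -> 'M[R]_(n.+1, N)})) => y; exact: cvg_snd.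
Qed.

Lemma smooth_on_td A f : open A -> smooth_on A f -> smooth_on A (total_derivative f).
Proof.
move=> oA sf; apply: smooth_onD => //; first exact: smooth_on_derive.
apply: smooth_on_sum => // j _; apply: smooth_on_sum => // d _.
apply: smooth_onM => //; first exact: smooth_on_derive.
exact: smooth_on_jet_coord.
Qed.

Lemma smooth_on_iter_td A f k : open A -> smooth_on A f ->
  smooth_on A (iter k total_derivative f).
Proof. by move=> oA sf; elim: k => //= k; exact: smooth_on_td. Qed.

Lemma eq_on_td A f g : open A -> (forall x, A x -> f x = g x) ->
  forall x, A x -> total_derivative f x = total_derivative g x.
Proof.
move=> oA fg x Ax; rewrite /total_derivative /ddt /ddq.
rewrite (eq_on_derive _ oA fg Ax); congr (_ + _).
by apply: eq_bigr => j _; apply: eq_bigr => d _; rewrite (eq_on_derive _ oA fg Ax).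
Qed.

Lemma eq_on_iter_td A f g k : open A -> (forall x, A x -> f x = g x) ->
  forall x, A x -> iter k total_derivative f x = iter k total_derivative g x.
Proof. by move=> oA fg; elim: k => //= k IH; exact: eq_on_td. Qed.

Lemma td0 (x : J) : total_derivative (fun _ : J => 0 : R) x = 0.
Proof.
rewrite /total_derivative /ddt /ddq derive_cst add0r.
by apply: big1 => j _; apply: big1 => d _; rewrite derive_cst mul0r.
Qed.

Lemma iter_td0 A f k : open A -> (forall x, A x -> f x = 0) ->
  forall x, A x -> iter k total_derivative f x = 0.
Proof.
move=> oA f0; elim: k => //= k IH x Ax.
by rewrite (eq_on_td oA IH)// td0.
Qed.

Lemma tdD A f g x : smooth_on A f -> smooth_on A g -> A x ->
  total_derivative (fun y => f y + g y) x = total_derivative f x + total_derivative g x.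
Proof.
move=> sf sg Ax; rewrite /total_derivative /ddt /ddq.
rewrite (smooth_deriveD _ sf sg Ax) addrACA; congr (_ + _).
rewrite -big_split; apply: eq_bigr => j _; rewrite -big_split; apply: eq_bigr => d _.
by rewrite (smooth_deriveD _ sf sg Ax) mulrDl.
Qed.

Lemma iter_tdD A f g k : open A -> smooth_on A f -> smooth_on A g ->
  forall x, A x -> iter k total_derivative (fun y => f y + g y) x =
    iter k total_derivative f x + iter k total_derivative g x.
Proof.
move=> oA sf sg; elim: k => //= k IH x Ax.
by rewrite (eq_on_td oA IH)// (tdD (smooth_on_iter_td k oA sf) (smooth_on_iter_td k oA sg)).
Qed.

Lemma smooth_on_ddq A f d i : smooth_on A f -> smooth_on A (ddq d i f).
Proof. exact: smooth_on_derive. Qed.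

Lemma ddq_ddq A f d i d' i' x : open A -> smooth_on A f -> A x ->
  ddq d i (ddq d' i' f) x = ddq d' i' (ddq d i f) x.
Proof. exact: derive_commute. Qed.

Lemma sum_delta_mx d (dn : (d < n)%N) (i : 'I_N) (c : nat -> 'I_N -> R) :
  \sum_(j < N) \sum_(e < n)
    c e j * (delta_mx (inord d.+1) i : 'M[R]_(n.+1, N)) (inord e.+1) j = c d i.
Proof.
rewrite (bigD1 i)//= (bigD1 (Ordinal dn))//= mxE !eqxx mulr1.
rewrite big1 => [|e ne]; last first.
  rewrite mxE; case: eqP => [/(congr1 val)|_]; last by rewrite mulr0.
  rewrite /= !inordK ?ltnS// => -[ed].
  by move: ne; rewrite -val_eqE /= ed eqxx.
rewrite addr0 big1 ?addr0// => j ji; apply: big1 => e _.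
by rewrite mxE (negbTE ji) andbF mulr0.
Qed.

(** The commutator of a jet derivative with the total derivative. The extra term arises when the
    derivative falls on the coefficient [q_(d+1)] of [d/dq_(d)], a term that is present in
    [total_derivative] because [d < n]. *)
Lemma ddq_td A f d i x : open A -> smooth_on A f -> A x -> (d < n)%N ->
  ddq d.+1 i (total_derivative f) x =
  total_derivative (ddq d.+1 i f) x + ddq d i f x.
Proof.
move=> oA sf Ax dn.
have sd e j : smooth_on A (ddq e j f) by exact: smooth_on_ddq.
have sx k j : smooth_on A (fun x : J => x.2 k j) by exact: smooth_on_jet_coord.
have st : smooth_on A (ddt f) by exact: smooth_on_derive.
have sm (j : 'I_N) (e : 'I_n) : smooth_on A (fun x => ddq e j f x * x.2 (inord e.+1) j).
  exact: (smooth_onM oA (sd e j) (sx (inord e.+1) j)).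
pose G (j : 'I_N) (e : 'I_n) (y : J) := ddq e j f y * y.2 (inord e.+1) j.
pose H j y := \sum_e G j e y; pose S y := \sum_j H j y.
have sH j : smooth_on A (H j) by apply: smooth_on_sum => // e _; exact: sm.
have sS : smooth_on A S by exact: smooth_on_sum.
have E0 : ddq d.+1 i (total_derivative f) x = ddq d.+1 i (ddt f) x + ddq d.+1 i S x.
  exact: (smooth_deriveD _ st sS Ax).
have E1 : ddq d.+1 i (ddt f) x = ddt (ddq d.+1 i f) x.
  exact: (derive_commute _ _ oA sf Ax).
have E2 : ddq d.+1 i S x =
    \sum_(j < N) \sum_(e < n) (ddq e j (ddq d.+1 i f) x * x.2 (inord e.+1) j +
      ddq e j f x * (delta_mx (inord d.+1) i : 'M[R]_(n.+1, N)) (inord e.+1) j).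
  pose v : J := (0, delta_mx (inord d.+1) i).
  have D1 : ddq d.+1 i S x = \sum_j 'D_v (H j) x.
    exact: (@smooth_derive_sum _ _ A _ (index_enum _) xpredT H v x (fun j _ => sH j) Ax).
  have D2 j : 'D_v (H j) x = \sum_e 'D_v (G j e) x.
    exact: (@smooth_derive_sum _ _ A _ (index_enum _) xpredT (G j) v x (fun e _ => sm j e) Ax).
  rewrite D1; apply: eq_bigr => j _; rewrite D2; apply: eq_bigr => e _.
  have D3 := derive_jet_coord (inord e.+1) j v x.
  apply: etrans (smooth_deriveM v (sd e j) (sx (inord e.+1) j) Ax) _.
  apply: (congr2 (fun a b => a * x.2 (inord e.+1) j + ddq e j f x * b) _ D3).
  exact: (ddq_ddq _ _ _ _ oA sf Ax).
rewrite E0 E1 E2 /total_derivative -addrA; congr (_ + _).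
under eq_bigr => j _ do rewrite big_split.
rewrite big_split /=; congr (_ + _).
exact: (sum_delta_mx dn i (fun e j => ddq e j f x)).
Qed.

(** An infinitesimal form of the order, local to [A], which passes to [ddq] and grows by one under
    [total_derivative]. The bound [d <= n] matters: beyond it [inord] returns its default, row
    [0]. *)
Definition ord_on A (k : nat) f := forall (d : nat) i x, (k < d <= n)%N -> A x ->
  ddq d i f x = 0.

Lemma ord_on_ddq A k f d i : open A -> smooth_on A f -> ord_on A k f ->
  ord_on A k (ddq d i f).
Proof.
move=> oA sf fk e j x ke Ax; rewrite (ddq_ddq _ _ _ _ oA sf Ax).
have E y : A y -> ddq e j f y = (fun=> 0) y by move=> Ay; rewrite fk.
by rewrite /ddq (eq_on_derive _ oA E Ax) derive_cst.
Qed.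

Lemma ord_on_td A k f : open A -> smooth_on A f -> ord_on A k f ->
  ord_on A k.+1 (total_derivative f).
Proof.
move=> oA sf fk [|d] i x //; rewrite ltnS => /andP[kd dn] Ax.
rewrite (ddq_td _ oA sf Ax dn) fk ?kd ?(ltnW dn)// addr0.
rewrite (eq_on_td oA (g := fun=> 0)) ?td0// => y Ay.
by rewrite fk// dn (ltn_trans kd).
Qed.

Lemma ord_on_iter_td A k f m : open A -> smooth_on A f -> ord_on A k f ->
  ord_on A (k + m) (iter m total_derivative f).
Proof.
move=> oA sf fk; elim: m => [|m IH]; first by rewrite addn0.
by rewrite addnS /=; apply: ord_on_td => //; exact: smooth_on_iter_td.
Qed.

Lemma momentumD A r b i f g x : open A -> smooth_on A f -> smooth_on A g -> A x ->
  momentum r b i (fun y => f y + g y) x = momentum r b i f x + momentum r b i g x.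
Proof.
move=> oA sf sg Ax; rewrite /momentum -big_split; apply: eq_bigr => d _ /=.
rewrite -mulrDr -(iter_tdD _ oA (smooth_on_ddq d i sf) (smooth_on_ddq d i sg) Ax).
congr (_ * _); apply: (eq_on_iter_td _ oA) => // y Ay.
exact: (smooth_deriveD _ sf sg Ay).
Qed.

(* The sum telescopes. *)
Lemma momentum_td A r b i f x : open A -> smooth_on A f -> A x ->
  (b < r <= n)%N -> (forall y, A y -> ddq r i f y = 0) ->
  momentum r b i (total_derivative f) x = ddq b i f x.
Proof.
move=> oA sf Ax /andP[br rn] fr.
pose g m := (-1) ^+ m * iter m total_derivative (ddq (b + m) i f) x.
rewrite /momentum -[b.+1]add0n big_addn subSS.
transitivity (\sum_(0 <= m < r - b) (g m - g m.+1)).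
  apply: eq_big_nat => m /andP[_ mrb].
  have -> : (m + b.+1 - b - 1 = m)%N by rewrite addnS subSn ?leq_addl// addnK subn1.
  have mn : (b + m < n)%N by apply: leq_trans rn; rewrite -ltn_subRL.
  have E y : A y -> ddq (m + b.+1) i (total_derivative f) y =
      (fun y => total_derivative (ddq (b + m.+1) i f) y + ddq (b + m) i f y) y.
    by move=> Ay; rewrite addnS addnC (ddq_td _ oA sf Ay mn) addnS.
  rewrite (eq_on_iter_td _ oA E Ax) (iter_tdD _ oA _ _ Ax).
  - by rewrite /g exprS mulN1r mulNr opprK -mulrDr -iterSr addrC.
  - by apply: smooth_on_td => //; exact: smooth_on_ddq.
  - exact: smooth_on_ddq.
rewrite big_mkord.
under eq_bigr do rewrite -opprB.
rewrite sumrN -(big_mkord xpredT (fun m => g m.+1 - g m)) telescope_sumr// opprB.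
rewrite /g subnKC ?(ltnW br)// (iter_td0 _ oA fr Ax) mulr0 subr0.
by rewrite expr0 mul1r addn0.
Qed.

End JetCalculus.

(** * Functions of jets and controls, evaluated along curves *)

Section JetCurves.
Context {R : realType} {N n M : nat}.
Local Notation J := (jet R N n).
Implicit Types (A : set J) (f g : J -> R) (Q : set 'rV[R]_N) (q : R -> 'rV[R]_N).

(** Coordinates on the jet space: [inl] is the time and [inr (beta, i)] is [q^i_(beta)]. They bring
    maps into jets to the form [\sum_k c k y *: b k] on which the chain rule operates. *)
Definition jet_index := (unit + 'I_n.+1 * 'I_N)%type.
Definition jet_basis (k : jet_index) : J :=
  match k with inl _ => (1, 0) | inr bi => (0, delta_mx bi.1 bi.2) end.
Definition jet_coef V (tau : V -> R) (m : V -> 'M[R]_(n.+1, N)) (k : jet_index) (y : V) : R :=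
  match k with inl _ => tau y | inr bi => m y bi.1 bi.2 end.

Lemma jet_sumE V (tau : V -> R) m (y : V) :
  \sum_k jet_coef tau m k y *: jet_basis k = (tau y, m y).
Proof.
rewrite big_sumType /= big_const card_unit /= addr0.
rewrite (eq_bigr (fun bi : 'I_n.+1 * 'I_N =>
  (0, m y bi.1 bi.2 *: delta_mx bi.1 bi.2) : J)); last first.
  by move=> bi _; apply/pair_equal_spec; split=> //=; rewrite scaler0.
have -> : \sum_(bi : 'I_n.+1 * 'I_N) ((0, m y bi.1 bi.2 *: delta_mx bi.1 bi.2) : J) = (0, m y).
  rewrite [in RHS](matrix_sum_delta (m y)) pair_big /=.
  elim/big_rec2: _ => // bi z z' _ ->.
  by apply/pair_equal_spec; split => //=; rewrite add0r.
by apply/pair_equal_spec; split=> /=; rewrite ?scaler0 ?add0r// addr0 [_ *: _]mulr1.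
Qed.

Definition jetctl_basis (k : jet_index + 'I_M) : (J * 'rV[R]_M)%type :=
  match k with inl k => (jet_basis k, 0) | inr a => (0, delta_mx 0 a) end.
Definition jetctl_coef V (tau : V -> R) m (w : V -> 'rV[R]_M) (k : jet_index + 'I_M) (y : V) : R :=
  match k with inl k => jet_coef tau m k y | inr a => w y 0 a end.

Lemma jetctl_sumE V (tau : V -> R) m w (y : V) :
  \sum_k jetctl_coef tau m w k y *: jetctl_basis k = ((tau y, m y), w y).
Proof.
rewrite big_sumType /= -jet_sumE.
have -> : \sum_(k : jet_index) jet_coef tau m k y *: ((jet_basis k, 0) : J * 'rV[R]_M) =
          (\sum_k jet_coef tau m k y *: jet_basis k, 0).
  elim/big_rec2: _ => // k z z' _ ->.
  by apply/pair_equal_spec; split => //=; rewrite scaler0 add0r.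
have -> : \sum_(a < M) w y 0 a *: ((0, delta_mx 0 a) : J * 'rV[R]_M) = (0, w y).
  rewrite [in RHS](matrix_sum_delta (w y)) big_ord1.
  elim/big_rec2: _ => // a z z' _ ->.
  by apply/pair_equal_spec; split => //=; rewrite scaler0 add0r.
by apply/pair_equal_spec; split => /=; rewrite ?addr0 ?add0r.
Qed.

Section Composition.
Variables (V : normedModType R) (B : set V) (tau : V -> R) (m : V -> 'M[R]_(n.+1, N)).
Variable w : V -> 'rV[R]_M.
Hypotheses (oB : open B) (stau : smooth_on B tau)
  (sm : forall b i, smooth_on B (fun y => m y b i))
  (sw : forall a, smooth_on B (fun y => w y 0 a)).

Let sjc k : smooth_on B (jet_coef tau m k).
Proof. by case: k => [?|[b i]]; [exact: stau|exact: sm]. Qed.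

Let sjcc k : smooth_on B (jetctl_coef tau m w k).
Proof. by case: k => [k|a]; [exact: sjc|exact: sw]. Qed.

Lemma smooth_on_jet_comp A f : smooth_on A f -> (forall y, B y -> A (tau y, m y)) ->
  smooth_on B (fun y => f (tau y, m y)).
Proof.
move=> sf BA.
have := smooth_on_comp oB sjc sf (b := jet_basis).
move=> H; apply: smooth_on_eq (H _) => // y By; rewrite jet_sumE//.
exact: BA.
Qed.

Lemma smooth_on_jetctl_comp (A : set (J * 'rV[R]_M)) (L : J * 'rV[R]_M -> R) :
  smooth_on A L -> (forall y, B y -> A ((tau y, m y), w y)) ->
  smooth_on B (fun y => L ((tau y, m y), w y)).
Proof.
move=> sL BA.
have := smooth_on_comp oB sjcc sL (b := jetctl_basis).
move=> H; apply: smooth_on_eq (H _) => // y By; rewrite jetctl_sumE//.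
exact: BA.
Qed.

Lemma derive_jet_comp A f v y : smooth_on A f -> A (tau y, m y) -> B y ->
  'D_v (fun y => f (tau y, m y)) y = 'D_v tau y * ddt f (tau y, m y) +
    \sum_(b < n.+1) \sum_(i < N) 'D_v (fun y => m y b i) y * ddq b i f (tau y, m y).
Proof.
move=> sf Ay By.
have dc k := smooth_on_diff (sjc k) By.
have df : differentiable f (\sum_k jet_coef tau m k y *: jet_basis k).
  by rewrite jet_sumE; exact: smooth_on_diff sf Ay.
have [_ D] := derive_comp_sum v dc df.
have E : (fun y => f (\sum_k jet_coef tau m k y *: jet_basis k)) = (fun y => f (tau y, m y)).
  by apply/funext => z; rewrite jet_sumE.
rewrite E in D; rewrite D jet_sumE big_sumType /= (big_pred1 tt) => [|[]//].
congr (_ + _); rewrite pair_big; apply: eq_bigr => -[b i] _ /=.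
by rewrite /ddq inord_val.
Qed.

Lemma derive_jetctl_comp (A : set (J * 'rV[R]_M)) (L : J * 'rV[R]_M -> R) v y :
  smooth_on A L -> A ((tau y, m y), w y) -> B y ->
  'D_v (fun y => L ((tau y, m y), w y)) y =
    'D_v tau y * 'D_((1, 0), 0) L ((tau y, m y), w y) +
    \sum_(b < n.+1) \sum_(i < N)
       'D_v (fun y => m y b i) y * 'D_((0, delta_mx b i), 0) L ((tau y, m y), w y) +
    \sum_(a < M) 'D_v (fun y => w y 0 a) y * 'D_(0, delta_mx 0 a) L ((tau y, m y), w y).
Proof.
move=> sL Ay By.
have dc k := smooth_on_diff (sjcc k) By.
have dL : differentiable L (\sum_k jetctl_coef tau m w k y *: jetctl_basis k).
  by rewrite jetctl_sumE; exact: smooth_on_diff sL Ay.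
have [_ D] := derive_comp_sum v dc dL.
have E : (fun y => L (\sum_k jetctl_coef tau m w k y *: jetctl_basis k)) =
         (fun y => L ((tau y, m y), w y)).
  by apply/funext => z; rewrite jetctl_sumE.
rewrite E in D; rewrite D jetctl_sumE !big_sumType /= (big_pred1 tt) => [|[]//].
by congr (_ + _ + _); rewrite pair_big.
Qed.

End Composition.

Section AlongCurve.
Variable q : R -> 'rV[R]_N.
Hypothesis sq : smooth_on setT q.

Let sqb b i : smooth_on setT (fun t => derive1n b q t 0 i).
Proof. by apply: smooth_on_coord; [exact: openT|exact: smooth_on_derive1n]. Qed.

Lemma smooth_on_njet_entry (B : set R) (b : 'I_n.+1) i :
  smooth_on B (fun t => deriv_matrix n.+1 q t b i).
Proof.
rewrite (_ : (fun t => _) = fun t => derive1n b q t 0 i).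
  exact: smooth_onS (@sqb b i).
by apply/funext => t; rewrite mxE.
Qed.

Lemma smooth_on_njet_comp A f (B : set R) : open B -> smooth_on A f ->
  (forall t, B t -> A (njet n q t)) -> smooth_on B (fun t => f (njet n q t)).
Proof.
move=> oB sf BA; have sid : smooth_on B (fun t : R => t).
  by have := @smooth_on_linear R R R B (@idfun R); apply=> x; exact: cvg_id.
exact: (smooth_on_jet_comp oB sid (smooth_on_njet_entry (B := B)) sf BA).
Qed.

(** The chain rule also yields a term with velocity [q_(n+1)], which an [n]-jet does not record. It
    drops out because [f] has order [k < n], and the remainder is the total derivative. *)
Lemma derive_njet_comp A f k t : smooth_on A f -> A (njet n q t) ->
  ord_on A k f -> (k < n)%N ->
  'D_1 (fun t => f (njet n q t)) t = total_derivative f (njet n q t).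
Proof.
move=> sf At fk kn.
have sid : smooth_on (setT : set R) (fun t : R => t).
  by have := @smooth_on_linear R R R setT (@idfun R); apply=> x; exact: cvg_id.
have := @derive_jet_comp _ setT (fun t => t) (deriv_matrix n.+1 q) sid
  (smooth_on_njet_entry (B := setT)) A f 1 t sf At I.
move=> ->; rewrite -/(njet n q t) derive_id mul1r /total_derivative; congr (_ + _).
rewrite big_ord_recr /= [X in _ + X]big1 ?addr0; last first.
  by move=> i _; rewrite fk ?mulr0// kn leqnn.
rewrite exchange_big /=; apply: eq_bigr => j _; apply: eq_bigr => d _.
rewrite mulrC; congr (_ * _); rewrite /njet /= mxE inordK ?ltnS//.
rewrite derive1nS derive1E -(@derive_coord _ _ _ _ setT) //; last exact: smooth_on_derive1n.
by congr ('D_1 _ t); apply/funext => s; rewrite mxE.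
Qed.

(** Every total derivative raises the order by one; [k + m <= n] keeps each function that is still
    to be differentiated below order [n]. *)
Lemma iter_td_along A f k m (B : set R) : open A -> open B -> smooth_on A f ->
  ord_on A k f -> (k + m <= n)%N -> (forall t, B t -> A (njet n q t)) ->
  forall t, B t -> iter m total_derivative f (njet n q t) =
    derive1n m (fun t => f (njet n q t)) t.
Proof.
move=> oA oB sf fk; elim: m => // m IH kmn BA t Bt.
rewrite derive1nS derive1E /= -(@derive_njet_comp A _ (k + m)).
- apply: (eq_on_derive _ oB) Bt => s Bs; apply: IH => //.
  by apply: leq_trans kmn; rewrite addnS.
- exact: smooth_on_iter_td.
- exact: BA.
- exact: ord_on_iter_td.
- by rewrite addnS in kmn.
Qed.

End AlongCurve.
End JetCurves.

(** * Variations *)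

Section VariationCalculus.
Context {R : realType} {T : R} {N M n r rt : nat} {Q : set 'rV[R]_N} {K : set 'rV[R]_M}.
Hypotheses (T_gt0 : 0 < T) (Q_open : open Q).
Variable D : defining_triple T n r rt Q K.
Variable F : controlled_variation D.

Let rn : (2 * r < n)%N. Proof. by have := r_le_n D; rewrite addn1. Qed.
Let le_r_n : (r <= n)%N.
Proof. by apply: leq_trans (ltnW rn); rewrite leq_pmull. Qed.

Definition entry (b : nat) (i : 'I_N) (p : R * R) : R :=
  iter b (@dt R _) (var_F F) p 0 i.

Lemma smooth_on_entry (O : set (R * R)) b i : smooth_on O (entry b i).
Proof.
apply: (@smooth_onS _ _ _ O setT) => //.
apply: smooth_on_coord; first exact: openT.
exact: smooth_on_iter_dt (var_F_smooth F).
Qed.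

Lemma dt_entry b i p : dt (entry b i) p = entry b.+1 i p.
Proof.
rewrite /dt /entry (@derive_coord _ _ _ _ setT)//.
exact: smooth_on_iter_dt (var_F_smooth F).
Qed.

Definition jets (p : R * R) : 'M[R]_(n.+1, N) := \matrix_(b, i) entry b i p.

Lemma njetE t s : njet n (qs F s) t = (t, jets (t, s)).
Proof.
rewrite /njet; congr pair; apply/matrixP => b i; rewrite !mxE.
by rewrite /qs derive1n_slice_t.
Qed.

Lemma row0_jets p : row ord0 (jets p) = var_F F p.
Proof. by apply/rowP => i; rewrite !mxE. Qed.

(* Contains, with a point [(t, s)], the endpoints [(0, s)] and [(T, s)] on
   which the boundary data of [h], [h'], [h''] depend. *)
Definition curve_domain : set (R * R) :=
  [set p | [/\ Q (var_F F p), Q (var_F F (0, p.2)) & Q (var_F F (T, p.2))]].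
Local Notation O := curve_domain.

Lemma curve_domain_rect t s : 0 <= t <= T -> 0 <= s <= 1 -> O (t, s).
Proof.
move=> tT s1; have [_ [_ HQ _ _]] := var_curve F (s1 : s \in `[0, 1]%R).
by split; apply: HQ; rewrite in_itv/= ?lexx ?(ltW T_gt0).
Qed.

Lemma open_curve_domain : open O.
Proof.
have cF : continuous (var_F F) by move=> p; exact: smooth_on_cont (var_F_smooth F) _.
have cf (t0 : R) : continuous (fun p : R * R => (t0, p.2)).
  have c2 : continuous (snd : R * R -> R) by move=> x; exact: cvg_snd.
  move=> p; have c1 : t0 @[_ --> p] --> t0 by exact: cvg_cst.
  exact: (@cvg_pair _ _ _ (nbhs p) (nbhs t0) (nbhs p.2) _ _ _ _ _ c1 (c2 p)).
have o1 : open [set p | Q (var_F F p)] by exact: (open_comp (fun p _ => cF p) Q_open).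
have o2 (t0 : R) : open [set p : R * R | Q (var_F F (t0, p.2))].
  exact: (open_comp (fun p _ => cf t0 p) o1).
rewrite (_ : O = [set p | Q (var_F F p)] `&` ([set p | Q (var_F F (0, p.2))] `&`
   [set p | Q (var_F F (T, p.2))])); first exact: openI o1 (openI (o2 _) (o2 _)).
by apply/seteqP; split=> [p []|p [? []]].
Qed.
Local Notation oO := open_curve_domain.

Lemma curve_domain_at0 p : O p -> O (0, p.2). Proof. by move=> []. Qed.
Lemma curve_domain_atT p : O p -> O (T, p.2). Proof. by move=> []. Qed.

Lemma Jn_jets p : O p -> Jn Q (p.1, jets p).
Proof. by move=> [Qp _ _]; rewrite /Jn /= row0_jets. Qed.

Lemma smooth_on_proj1 (A : set (R * R)) : smooth_on A (fun p => p.1).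
Proof.
apply: (@smooth_on_linear R (R * R)%type R A (fst : {linear (R * R)%type -> R})) => x.
exact: cvg_fst.
Qed.

Let sm b i : smooth_on O (fun p => jets p b i).
Proof.
apply: (@smooth_on_eq _ _ _ O (entry b i) _ oO) => [p _|]; first by rewrite mxE.
exact: smooth_on_entry.
Qed.

Let sw a : smooth_on O (fun p => var_u F p 0 a).
Proof.
apply: smooth_on_coord oO _; exact: smooth_onS (var_u_smooth F).
Qed.

Lemma smooth_on_along (f : jet R N n * 'rV[R]_M -> R) :
  smooth_on [set xw | Jn Q xw.1] f ->
  smooth_on O (fun p => f ((p.1, jets p), var_u F p)).
Proof.
move=> sf; apply: (smooth_on_jetctl_comp oO (smooth_on_proj1 (A := O)) sm sw sf).
exact: Jn_jets.
Qed.

Lemma smooth_on_jets_comp (f : jet R N n -> R) :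
  smooth_on (Jn Q) f -> smooth_on O (fun p => f (p.1, jets p)).
Proof.
move=> sf; apply: (smooth_on_jet_comp oO (smooth_on_proj1 (A := O)) sm sf).
exact: Jn_jets.
Qed.

Definition lagr (p : R * R) : R := dtL D ((p.1, jets p), var_u F p).
(** The partial derivative is taken with the control frozen; a later [dt] also differentiates
    through the control, in agreement with total derivatives of [controlled]. *)
Definition lagr_q (d : nat) (i : 'I_N) (p : R * R) : R :=
  'D_((0, delta_mx (inord d) i), 0) (dtL D) ((p.1, jets p), var_u F p).
Definition lagr_u (a : 'I_M) (p : R * R) : R :=
  'D_(0, delta_mx 0 a) (dtL D) ((p.1, jets p), var_u F p).

Lemma smooth_on_lagr : smooth_on O lagr.
Proof. exact: smooth_on_along (dtL_smooth D). Qed.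

Lemma smooth_on_lagr_q d i : smooth_on O (lagr_q d i).
Proof.
pose v : jet R N n * 'rV[R]_M := ((0, delta_mx (inord d) i), 0).
exact: (smooth_on_along (smooth_on_derive v (dtL_smooth D))).
Qed.

Lemma ddq_controlled d i t s :
  ddq d i (controlled (dtL D) (us F s)) (njet n (qs F s) t) = lagr_q d i (t, s).
Proof.
rewrite njetE; apply: eq_derive_line => [h|//].
rewrite /controlled; congr (dtL D _); apply/pair_equal_spec; split => //=.
by rewrite !scaler0 !add0r.
Qed.

Lemma us_control t s : 0 <= t <= T -> 0 <= s <= 1 -> K (var_u F (t, s)).
Proof.
move=> tT s1; have [DU _] := var_curve F (s1 : s \in `[0, 1]%R).
by have [_] := dtK_control DU; apply; rewrite in_itv.
Qed.

Lemma smooth_on_us s : 0 <= s <= 1 -> smooth_on setT (us F s).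
Proof.
move=> s1; have [DU _] := var_curve F (s1 : s \in `[0, 1]%R).
by have [] := dtK_control DU.
Qed.

Lemma smooth_on_qs s : 0 <= s <= 1 -> smooth_on setT (qs F s).
Proof. by move=> s1; have [_ []] := var_curve F (s1 : s \in `[0, 1]%R). Qed.

(** Restricted to the closed rectangle, because the order of [dtL] is only given for controls in
    [K], and the extended controls may leave [K] elsewhere. *)
Lemma lagr_q_order d i t s : (r < d <= n)%N -> 0 <= t <= T -> 0 <= s <= 1 ->
  lagr_q d i (t, s) = 0.
Proof.
move=> /andP[rd dn] tT s1; apply: derive_invariant => h /=.
have [Jp Ku] := (Jn_jets (curve_domain_rect tT s1), us_control tT s1).
have E : h *: ((0, delta_mx (inord d) i), 0) + ((t, jets (t, s)), var_u F (t, s)) =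
  ((t, h *: delta_mx (inord d) i + jets (t, s)), var_u F (t, s)) :> (jet R N n * 'rV[R]_M).
  by apply/pair_equal_spec; split=> /=; [apply/pair_equal_spec; split=> //=|];
    rewrite scaler0 add0r.
rewrite E; apply: (dtL_order D Ku (x := (t, h *: delta_mx (inord d) i + jets (t, s)))
  (y := (t, jets (t, s)))) => //.
  (* The perturbed row [d] differs from row [0] since [d > r], so the base point in [Q] does not
     move. *)
  rewrite /Jn /=; rewrite (_ : row _ _ = row ord0 (jets (t, s)))//.
  apply/rowP => j; rewrite !mxE (_ : (ord0 == _) = false) ?mulr0 ?add0r//.
  by apply/eqP => /(congr1 val); rewrite /= inordK ?ltnS// => d0; rewrite -d0 in rd.
move=> b j br; rewrite /= [in LHS]mxE [X in X + _]mxE mxE (_ : (b == _) = false).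
  by rewrite mulr0 add0r.
by apply/eqP => bd; move: br; rewrite bd inordK ?ltnS// leqNgt rd.
Qed.

(** The momenta of [L] with [t]-derivatives along the variation in place of total derivatives; in
    this form they are visibly smooth in [(t, s)]. *)
Definition curve_momentum (b : nat) (i : 'I_N) (p : R * R) : R :=
  \sum_(b.+1 <= d < r.+1) (-1) ^+ (d - b - 1) * iter (d - b - 1) (@dt R R) (lagr_q d i) p.

Lemma smooth_on_curve_momentum b i : smooth_on O (curve_momentum b i).
Proof.
apply: smooth_on_sum oO _ => d _; apply: smooth_onMl oO _.
exact: smooth_on_iter_dt (smooth_on_lagr_q d i).
Qed.

Lemma smooth_on_controlled s : 0 <= s <= 1 ->
  smooth_on (Jn Q) (controlled (dtL D) (us F s)).
Proof.
move=> s1; have oJ : open (Jn (n := n) Q) by exact: open_Jn.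
have sfst (i : unit) : smooth_on (Jn Q) (fst : jet R N n -> R).
  apply: (@smooth_on_linear R _ R _ (fst : {linear (jet R N n) -> R})) => x.
  exact: cvg_fst.
have su a : smooth_on (Jn Q) (fun x : jet R N n => us F s x.1 0 a).
  have sua : smooth_on setT (fun t => us F s t 0 a).
    by apply: smooth_on_coord; [exact: openT|exact: smooth_on_us].
  have := smooth_on_comp (b := fun=> 1 : R) oJ sfst sua (fun _ _ => I).
  apply: smooth_on_eq => // p _.
  by rewrite big_const card_unit /= addr0 [_ *: _]mulr1.
have := smooth_on_jetctl_comp oJ (sfst tt) (fun b i => smooth_on_jet_coord b i oJ) su
  (dtL_smooth D).
move=> H; apply: smooth_on_eq (H _) => // -[t m] //.
Qed.

(** The time is confined to the open interval: there the control lies in [K], and the set is open,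
    as the calculus of [ord_on] requires. *)
Lemma ord_on_controlled s : 0 <= s <= 1 ->
  ord_on (Jn Q `&` [set x | 0 < x.1 < T]) r (controlled (dtL D) (us F s)).
Proof.
move=> s1 d i x /andP[rd dn] [Jx /= /andP[x0 xT]]; apply: derive_invariant => h.
rewrite /= /controlled /= scaler0 add0r.
have tT : 0 <= x.1 <= T by rewrite !ltW.
apply: (dtL_order D (us_control tT s1)
  (x := h *: (0, delta_mx (inord d) i) + x) (y := x)) => //=; last first.
- move=> b j br; rewrite [in LHS]mxE [X in X + _]mxE mxE (_ : (b == _) = false).
    by rewrite mulr0 add0r.
  by apply/eqP => bd; move: br; rewrite bd inordK ?ltnS// leqNgt rd.
- by rewrite scaler0 add0r.
rewrite /Jn /=; rewrite (_ : row _ _ = row ord0 x.2)//.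
apply/rowP => j; rewrite !mxE (_ : (ord0 == _) = false) ?mulr0 ?add0r//.
by apply/eqP => /(congr1 val); rewrite /= inordK ?ltnS// => d0; rewrite -d0 in rd.
Qed.

Lemma open_interior_jets : open (Jn (n := n) Q `&` [set x | 0 < x.1 < T]).
Proof.
apply: openI; first exact: open_Jn.
have cf : continuous (fst : jet R N n -> R) by move=> x; exact: cvg_fst.
have oI : open (`]0, T[%classic : set R) by exact: interval_open.
have := open_comp (fun p _ => cf p) oI.
by rewrite (_ : _ @^-1` _ = [set x | 0 < x.1 < T]).
Qed.

Lemma iter_td_controlled d i m t s : (r + m <= n)%N -> 0 < t < T -> 0 <= s <= 1 ->
  iter m total_derivative (ddq d i (controlled (dtL D) (us F s))) (njet n (qs F s) t) =
  iter m (@dt R R) (lagr_q d i) (t, s).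
Proof.
move=> rm tT s1; have oA := open_interior_jets.
have oI : open (`]0, T[%classic : set R) by exact: interval_open.
have sf : smooth_on (Jn Q `&` [set x | 0 < x.1 < T]) (controlled (dtL D) (us F s)).
  by apply: smooth_onS (smooth_on_controlled s1) => x [].
rewrite (iter_td_along (smooth_on_qs s1) (B := `]0, T[%classic) oA oI
  (smooth_on_ddq d i sf) (ord_on_ddq d i oA sf (ord_on_controlled s1)) rm) //=.
- transitivity (derive1n m (fun t => lagr_q d i (t, s)) t).
    by congr (derive1n m _ t); apply/funext => t'; exact: ddq_controlled.
  by rewrite derive1n_slice_t.
- move=> t'; rewrite in_itv/= => /andP[t0 t'T]; rewrite njetE; split=> /=.
    by apply: (@Jn_jets (t', s)); apply: curve_domain_rect; rewrite // !ltW.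
  by rewrite t0.
Qed.

(** Interior times come from [iter_td_controlled], the order count being
    [r + (d - b - 1) <= 2 * r < n]. The endpoints, where the boundary data of [h] and [h'] are read
    off, follow by continuity in [t]. *)
Lemma momentumE b i t s : 0 <= t <= T -> 0 <= s <= 1 ->
  momentum r b i (controlled (dtL D) (us F s)) (njet n (qs F s) t) =
  curve_momentum b i (t, s).
Proof.
move=> tT s1.
pose B := [set t | Q (qs F s t)].
have cq : continuous (qs F s) by move=> x; exact: smooth_on_cont (smooth_on_qs s1) _.
have oB : open B by exact: (open_comp (fun p _ => cq p) Q_open).
have oJ : open (Jn (n := n) Q) by exact: open_Jn.
apply: (@continuous_eq_closed _ _
  (fun t => momentum r b i (controlled (dtL D) (us F s)) (njet n (qs F s) t))
  (fun t => curve_momentum b i (t, s)) 0 T) => // {tT}t tT.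
- have Bt : B t.
    by have [Qp _ _] := curve_domain_rect tT s1.
  apply: (smooth_on_cont (A := B)) Bt.
  apply: smooth_on_sum => // d _; apply: smooth_onMl => //.
  apply: (smooth_on_njet_comp (smooth_on_qs s1) (A := Jn Q)) => //.
    by apply: smooth_on_iter_td => //; apply: smooth_on_ddq; exact: smooth_on_controlled.
  by move=> t' Qt'; rewrite njetE /Jn /= row0_jets.
- apply: cont_slice_l; apply: (smooth_on_cont (smooth_on_curve_momentum b i)).
  exact: curve_domain_rect.
apply: eq_big_nat => d /andP[bd dr]; rewrite iter_td_controlled//.
apply: leq_trans (ltnW rn); rewrite mul2n -addnn leq_add2l.
by rewrite -subnDA leq_subLR; rewrite ltnS in dr; apply: leq_trans dr _; rewrite leq_addl.
Qed.

Lemma EL_along i t s : 0 < t < T -> 0 <= s <= 1 ->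
  lagr_q 0 i (t, s) + \sum_(1 <= b < r.+1)
    (-1) ^+ b * iter b (@dt R R) (lagr_q b i) (t, s) = 0.
Proof.
move=> tT s1; have /andP[t0 t1] := tT.
have [_ [_ _ EL _]] := var_curve F (s1 : s \in `[0, 1]%R).
have := EL t i; rewrite in_itv/= !ltW// => /(_ isT) ELt; rewrite -[RHS]ELt.
rewrite /EL_operator -ddq_controlled; congr (_ + _).
apply: eq_big_nat => b /andP[_ br]; congr (_ * _).
apply/esym; apply: iter_td_controlled => //.
by apply: leq_trans (ltnW rn); rewrite mul2n -addnn leq_add2l.
Qed.

Lemma curve_momentum_top i p : curve_momentum r i p = 0.
Proof. by rewrite /curve_momentum big_geq. Qed.

Lemma dt_curve_momentum b i p : O p -> dt (curve_momentum b i) p =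
  \sum_(b.+1 <= d < r.+1) (-1) ^+ (d - b - 1) * iter (d - b - 1).+1 (@dt R R) (lagr_q d i) p.
Proof.
move=> Op.
pose G (d : nat) q := (-1) ^+ (d - b - 1) * iter (d - b - 1) (@dt R R) (lagr_q d i) q.
have sit d : smooth_on O (iter (d - b - 1) (@dt R R) (lagr_q d i)).
  exact: smooth_on_iter_dt (smooth_on_lagr_q d i).
have sG d : smooth_on O (G d) by exact: (smooth_onMl _ oO (sit d)).
transitivity (\sum_(b.+1 <= d < r.+1) dt (G d) p).
  exact: (@smooth_derive_sum _ _ O _ (index_iota b.+1 r.+1) xpredT G (1, 0) p (fun d _ => sG d) Op).
apply: eq_bigr => d _; exact: (@smooth_deriveMl _ _ O ((-1) ^+ (d - b - 1)) _ (1, 0) p (sit d) Op).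
Qed.

(** Recursion of the Ostrogradsky momenta: the term [d = b + 1] splits off, and the others are minus
    the [t]-derivative of the next momentum. *)
Lemma curve_momentum_rec b i p : (b < r)%N -> O p ->
  curve_momentum b i p = lagr_q b.+1 i p - dt (curve_momentum b.+1 i) p.
Proof.
move=> br Op; rewrite {1}/curve_momentum big_ltn// subSnn subnn expr0 mul1r /=.
congr (_ + _); rewrite dt_curve_momentum// -sumrN; apply: eq_big_nat => d /andP[bd _].
have -> : (d - b - 1 = (d - b.+1 - 1).+1)%N.
  by rewrite -!subnDA !addn1 subnSK// -addn1.
by rewrite exprS mulN1r mulNr.
Qed.

(** Formally the same recursion at [b = -1], where the momentum would be the Euler-Lagrange
    expression and hence vanishes. *)
Lemma EL_momentum i t s : 0 < t < T -> 0 <= s <= 1 ->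
  lagr_q 0 i (t, s) = dt (curve_momentum 0 i) (t, s).
Proof.
move=> tT s1; have Op : O (t, s).
  by move: tT => /andP[? ?]; apply: curve_domain_rect => //; rewrite !ltW.
apply/eqP; rewrite -subr_eq0 -[X in _ == X](EL_along i tT s1) dt_curve_momentum//.
rewrite eq_sym; apply/eqP; congr (_ + _); rewrite -sumrN; apply: eq_big_nat => d /andP[d0 _].
case: d d0 => // d _; rewrite subn0 subn1 /=.
by rewrite exprS mulN1r mulNr.
Qed.

(** For [a b] the derivative of [L] in [q_(b)], [P] the momenta, [P'] their [t]-derivatives and
    [X b = ds q_(b)], the right-hand side is [d/dt] of [\sum P b * X b], as [dt (X b) = X b.+1]. The
    hypotheses are the momentum recursion and its two ends. *)
Lemma summation_by_parts (a P P' X : nat -> R) m : P' m = 0 -> a 0%N = P' 0%N ->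
  (forall b, (b < m)%N -> a b.+1 = P b + P' b.+1) ->
  \sum_(b < m.+1) a b * X b = \sum_(b < m) (P' b * X b + P b * X b.+1).
Proof.
move=> P'm a0 aS; rewrite big_ord_recl /= a0.
under eq_bigr => b _ do rewrite /bump /= add1n (aS _ (ltn_ord b)) mulrDl.
rewrite !big_split /= [X in _ + X]addrC addrA; congr (_ + _).
transitivity (\sum_(b < m.+1) P' b * X b); first by rewrite big_ord_recl.
by rewrite big_ord_recr /= P'm mul0r addr0.
Qed.

Lemma lagr_q_ds t s : 0 < t < T -> 0 <= s <= 1 ->
  \sum_(b < n.+1) \sum_(i < N) ds (entry b i) (t, s) * lagr_q b i (t, s) =
  \sum_(i < N) \sum_(b < r) (dt (curve_momentum b i) (t, s) * ds (entry b i) (t, s) +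
     curve_momentum b i (t, s) * ds (entry b.+1 i) (t, s)).
Proof.
move=> tT s1; have tT' : 0 <= t <= T by move: tT => /andP[? ?]; rewrite !ltW.
have Op := curve_domain_rect tT' s1.
rewrite exchange_big /=; apply: eq_bigr => i _.
pose a b := lagr_q b i (t, s); pose P' b := dt (curve_momentum b i) (t, s).
pose P b := curve_momentum b i (t, s); pose X b := ds (entry b i) (t, s).
rewrite -(@summation_by_parts a P P' X r).
- rewrite (big_ord_widen n.+1 (fun b => a b * X b)) ?ltnS// [RHS]big_mkcond /=.
  apply: eq_bigr => b _; rewrite mulrC; case: ifP => // /negbT.
  by rewrite -leqNgt => rb; rewrite lagr_q_order ?mul0r// rb -ltnS ltn_ord.
- rewrite /P' (eq_on_dt oO (G := fun=> 0)) => [|p _|//]; first exact: derive_cst.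
  exact: curve_momentum_top.
- exact: EL_momentum.
- by move=> b br; rewrite /a /P /P' (curve_momentum_rec i br Op) subrK.
Qed.

(** * The terminal cost and the boundary data at [T] *)

Hypothesis rt_lt_r : (rt < r)%N.

Definition cost (p : R * R) : R := dtC D (p.1, jets p).
Definition cost_q (b : nat) (i : 'I_N) (p : R * R) : R := ddq b i (dtC D) (p.1, jets p).

Lemma smooth_on_cost : smooth_on O cost.
Proof. exact: smooth_on_jets_comp (dtC_smooth D). Qed.

Lemma smooth_on_cost_q b i : smooth_on O (cost_q b i).
Proof. exact: smooth_on_jets_comp (smooth_on_ddq b i (dtC_smooth D)). Qed.

Lemma ddq_cost d i x : (rt < d <= n)%N -> Jn Q x -> ddq d i (dtC D) x = 0.
Proof.
move=> /andP[rd dn] Jx; apply: derive_invariant => h.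
apply: (dtC_order D (x := h *: (0, delta_mx (inord d) i) + x) (y := x)) => //=; last first.
- move=> b j br; rewrite mxE [X in X + _]mxE mxE (_ : (b == _) = false).
    by rewrite mulr0 add0r.
  by apply/eqP => bd; move: br; rewrite bd inordK ?ltnS// leqNgt rd.
- by rewrite scaler0 add0r.
rewrite /Jn /=; rewrite (_ : row _ _ = row ord0 x.2)//.
apply/rowP => j; rewrite !mxE (_ : (ord0 == _) = false) ?mulr0 ?add0r//.
by apply/eqP => /(congr1 val); rewrite /= inordK ?ltnS// => d0; rewrite -d0 in rd.
Qed.

Lemma momentum_terminal b i s : (b < r)%N -> 0 <= s <= 1 ->
  momentum r b i (fun x => controlled (dtL D) (us F s) x + total_derivative (dtC D) x)
    (njet n (qs F s) T) = curve_momentum b i (T, s) + cost_q b i (T, s).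
Proof.
move=> br s1; have oJ : open (Jn (n := n) Q) by exact: open_Jn.
have TT : 0 <= T <= T by rewrite lexx ltW.
have Jx : Jn Q (njet n (qs F s) T).
  by rewrite njetE; exact: (Jn_jets (curve_domain_rect TT s1)).
rewrite (momentumD r b i oJ (smooth_on_controlled s1) (smooth_on_td oJ (dtC_smooth D)) Jx).
rewrite momentumE//; congr (_ + _).
rewrite (momentum_td (i := i) oJ (dtC_smooth D) Jx (r := r)) ?njetE ?br//.
by move=> y Jy; apply: ddq_cost => //; rewrite rt_lt_r.
Qed.

Lemma ds_cost s : 0 <= s <= 1 ->
  ds cost (T, s) = \sum_(b < r) \sum_(i < N) ds (entry b i) (T, s) * cost_q b i (T, s).
Proof.
move=> s1; have TT : 0 <= T <= T by rewrite lexx ltW.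
have OT := curve_domain_rect TT s1.
have dfst : ds (fun p : R * R => p.1) (T, s) = 0.
  by rewrite -derive_slice_s derive_cst.
have djets (b : 'I_n.+1) i : ds (fun p => jets p b i) (T, s) = ds (entry b i) (T, s).
  by congr (ds _ _); apply/funext => p; rewrite mxE.
have := derive_jet_comp (smooth_on_proj1 (A := O)) sm (0, 1)
  (dtC_smooth D) (Jn_jets OT) OT.
rewrite -/(ds cost _) => ->; rewrite -/(ds (fun p : R * R => p.1) (T, s)) dfst mul0r add0r.
rewrite (big_ord_widen n.+1 (fun b => \sum_(i < N) ds (entry b i) (T, s) * cost_q b i (T, s))).
  rewrite [RHS]big_mkcond /=; apply: eq_bigr => b _; case: ifP => [_|/negbT].
    by apply: eq_bigr => i _; rewrite -/(ds _ _) djets.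
  rewrite -leqNgt => rb; apply: big1 => i _.
  rewrite (ddq_cost i (d := b) _ (Jn_jets OT)) ?mulr0// (leq_trans rt_lt_r rb).
  by rewrite -ltnS ltn_ord.
exact: leqW.
Qed.

(* [H], [H1], [H2] are [h], [h'], [h''] as functions of [(t, s)]. *)
Record boundary_functions (H H1 H2 : nat -> 'I_N -> R * R -> R) : Prop := {
  bf_smooth : forall b i, smooth_on O (H b i);
  bf_smooth1 : forall b i, smooth_on O (H1 b i);
  bf_smooth2 : forall b i, smooth_on O (H2 b i);
  bf_h : forall b i s, (b < r)%N -> 0 <= s <= 1 -> h_ F s b i = fun t => H b i (t, s);
  bf_h1 : forall b i s, (b < r)%N -> 0 <= s <= 1 -> h'_ F s b i = fun t => H1 b i (t, s);
  bf_h2 : forall b i s, (b < r)%N -> 0 <= s <= 1 -> h''_ F s b i = fun t => H2 b i (t, s);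
  bf_ode : forall b i p, dt (dt (H b i)) p = H b i p;
  bf_ode1 : forall b i p, dt (dt (dt (dt (H1 b i)))) p = omega4 T * H1 b i p;
  bf_ode2 : forall b i p, dt (dt (dt (dt (H2 b i)))) p = omega4 T * H2 b i p;
  bf_at0 : forall b i s, H b i (0, s) = entry b i (0, s) /\
    dt (H b i) (0, s) = - curve_momentum b i (0, s);
  bf_at01 : forall b i s, dt (H1 b i) (0, s) = 0;
  bf_at02 : forall b i s, dt (H2 b i) (0, s) = 0;
  bf_atT1 : forall b i s, dt (H1 b i) (T, s) = entry b i (T, s) /\
    dt (dt (H1 b i)) (T, s) = curve_momentum b i (T, s) + cost_q b i (T, s);
  bf_atT2 : forall b i s, dt (H2 b i) (T, s) = H b i (T, s) /\
    dt (dt (H2 b i)) (T, s) = dt (H b i) (T, s)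
}.

(** The coefficients of the fundamental solutions are boundary data frozen at [t = 0] or [t = T],
    hence smooth in [s]. The functions [H2] are built last because their data at [T] come from
    [H]. *)
Lemma boundary_functions_exist : exists H H1 H2, boundary_functions H H1 H2.
Proof.
have [Ch [Sh [[sCh sSh] [Ch2 Sh2] [Ch0 Ch0'] [Sh0 Sh0'] odeE]]] := @ode2_solutionE R.
have [E1 [E2 [[sE1 sE2] [E14 E24] [E10 E10' E20 E20'] [E1T E1T' E2T E2T'] ode4E]]] :=
  ode4_solutionE T_gt0.
pose H b i := separated (fun s => entry b i (0, s)) Ch
                        (fun s => - curve_momentum b i (0, s)) Sh.
pose H1 b i := separated (fun s => entry b i (T, s)) E1
                 (fun s => curve_momentum b i (T, s) + cost_q b i (T, s)) E2.
pose H2 b i := separated (fun s => H b i (T, s)) E1 (fun s => dt (H b i) (T, s)) E2.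
have HE k b i : iter k (@dt R R) (H b i) = separated (fun s => entry b i (0, s))
   (derive1n k Ch) (fun s => - curve_momentum b i (0, s)) (derive1n k Sh).
  exact: iter_dt_separated.
have H1E k b i : iter k (@dt R R) (H1 b i) = separated (fun s => entry b i (T, s))
   (derive1n k E1) (fun s => curve_momentum b i (T, s) + cost_q b i (T, s)) (derive1n k E2).
  exact: iter_dt_separated.
have H2E k b i : iter k (@dt R R) (H2 b i) = separated (fun s => H b i (T, s))
   (derive1n k E1) (fun s => dt (H b i) (T, s)) (derive1n k E2).
  exact: iter_dt_separated.
have sf0 (f : R * R -> R) : smooth_on O f -> smooth_on O (fun p => f (0, p.2)).
  by move=> sf; apply: (smooth_on_freeze_t oO sf); exact: curve_domain_at0.
have sfT (f : R * R -> R) : smooth_on O f -> smooth_on O (fun p => f (T, p.2)).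
  by move=> sf; apply: (smooth_on_freeze_t oO sf); exact: curve_domain_atT.
have sH b i : smooth_on O (H b i).
  have se := sf0 _ (@smooth_on_entry O b i).
  have sc := smooth_onN oO (sf0 _ (smooth_on_curve_momentum b i)).
  exact: (smooth_on_separated (al := fun s => entry b i (0, s))
    (be := fun s => - curve_momentum b i (0, s)) oO se sc sCh sSh).
have hE b i s : (b < r)%N -> 0 <= s <= 1 -> h_ F s b i = fun t => H b i (t, s).
  move=> br s1; have T0 : 0 <= (0 : R) <= T by rewrite lexx ltW.
  rewrite /h_ /hh odeE momentumE//.
  by rewrite /qs derive1n_slice_t.
exists H; exists H1; exists H2; split => //.
- move=> b i; have se := sfT _ (@smooth_on_entry O b i).
  have sc := smooth_onD oO (sfT _ (smooth_on_curve_momentum b i)) (sfT _ (smooth_on_cost_q b i)).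
  exact: (smooth_on_separated (al := fun s => entry b i (T, s))
    (be := fun s => curve_momentum b i (T, s) + cost_q b i (T, s)) oO se sc sE1 sE2).
- move=> b i; have se := sfT _ (sH b i); have sc := sfT _ (smooth_on_dt (sH b i)).
  exact: (smooth_on_separated (al := fun s => H b i (T, s))
    (be := fun s => dt (H b i) (T, s)) oO se sc sE1 sE2).
- move=> b i s br s1; rewrite /h'_ /hh' ode4E momentum_terminal//.
  by rewrite /qs derive1n_slice_t.
- move=> b i s br s1; rewrite /h''_ /hh'' ode4E -/(h_ F s b i) hE//.
  by rewrite derive1_slice_t.
- move=> b i p; rewrite -[LHS]/(iter 2 (@dt R R) (H b i) p) HE.
  by rewrite /H /separated Ch2 Sh2.
- move=> b i p; rewrite -[LHS]/(iter 4 (@dt R R) (H1 b i) p) H1E.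
  by rewrite /H1 /separated E14 E24; ring.
- move=> b i p; rewrite -[LHS]/(iter 4 (@dt R R) (H2 b i) p) H2E.
  by rewrite /H2 /separated E14 E24; ring.
- move=> b i s; split; first by rewrite /H /separated /= Ch0 Sh0; ring.
  by rewrite -[LHS]/(iter 1 (@dt R R) (H b i) (0, s)) HE /separated /= ?derive1n1 Ch0' Sh0'; ring.
- move=> b i s; rewrite -[LHS]/(iter 1 (@dt R R) (H1 b i) (0, s)) H1E.
  by rewrite /separated /= ?derive1n1 E10' E20'; ring.
- move=> b i s; rewrite -[LHS]/(iter 1 (@dt R R) (H2 b i) (0, s)) H2E.
  by rewrite /separated /= ?derive1n1 E10' E20'; ring.
- move=> b i s; rewrite -[dt (H1 b i) _]/(iter 1 (@dt R R) (H1 b i) (T, s)).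
  rewrite -[dt (dt (H1 b i)) _]/(iter 2 (@dt R R) (H1 b i) (T, s)) !H1E /separated.
  by rewrite ?derive1n1 E1T E2T E1T' E2T'; split; rewrite /=; ring.
- move=> b i s; rewrite -[dt (H2 b i) _]/(iter 1 (@dt R R) (H2 b i) (T, s)).
  rewrite -[dt (dt (H2 b i)) _]/(iter 2 (@dt R R) (H2 b i) (T, s)) !H2E /separated.
  by rewrite ?derive1n1 E1T E2T E1T' E2T'; split; rewrite /=; ring.
Qed.

(** * First variation of the quadratic terms *)

Let Op t s : 0 <= t <= T -> 0 <= s <= 1 -> O (t, s) := @curve_domain_rect t s.

(** [quad2] and [quad4] are Lagrangians whose Euler-Lagrange equations are [f'' = f] and
    [f'''' = omega4 * f]. On solutions their [s]-derivatives are therefore total [t]-derivatives, of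
    the momentum terms [flux2], [kin4] and [flux4]. *)
Definition quad2 (f : R * R -> R) p := dt f p * dt f p + f p * f p.
Definition quad4 (f : R * R -> R) p := omega4 T * (f p * f p) - dt (dt f) p * dt (dt f) p.
Definition kin4 (f : R * R -> R) p := dt (dt (dt f)) p * ds f p.
Definition flux2 (f : R * R -> R) p := dt f p * ds f p.
Definition flux4 (f : R * R -> R) p := dt (dt f) p * ds (dt f) p.

Section QuadraticForms.
Variable f : R * R -> R.
Hypothesis sf : smooth_on O f.
Let s1 := smooth_on_dt sf.
Let s2 := smooth_on_dt s1.
Let s3 := smooth_on_dt s2.
Let sd := smooth_on_ds sf.
Let sd1 := smooth_on_ds s1.

Lemma smooth_on_quad2 : smooth_on O (quad2 f).
Proof. exact: (smooth_onD oO (smooth_onM oO s1 s1) (smooth_onM oO sf sf)). Qed.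

Lemma smooth_on_quad4 : smooth_on O (quad4 f).
Proof.
exact: (smooth_onB oO (smooth_onMl _ oO (smooth_onM oO sf sf)) (smooth_onM oO s2 s2)).
Qed.

Lemma smooth_on_kin4 : smooth_on O (kin4 f).
Proof. exact: (smooth_onM oO s3 sd). Qed.

Lemma smooth_on_flux2 : smooth_on O (flux2 f).
Proof. exact: (smooth_onM oO s1 sd). Qed.

Lemma smooth_on_flux4 : smooth_on O (flux4 f).
Proof. exact: (smooth_onM oO s2 sd1). Qed.

Lemma ds_quad2 p : O p -> dt (dt f) p = f p -> ds (quad2 f) p = 2 * dt (flux2 f) p.
Proof.
move=> Opp ode.
have E : ds (quad2 f) p = (ds (dt f) p * dt f p + dt f p * ds (dt f) p) +
    (ds f p * f p + f p * ds f p).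
  apply: etrans (smooth_deriveD _ (smooth_onM oO s1 s1) (smooth_onM oO sf sf) Opp) _.
  exact: congr2 (dsM s1 s1 Opp) (dsM sf sf Opp).
have alg (S L x0 x1 x2 d0 d1 y0 : R) : S = (d1 * x1 + x1 * d1) + (d0 * x0 + x0 * d0) ->
    L = x2 * d0 + x1 * y0 -> x2 = x0 -> d1 = y0 -> S = 2 * L.
  by move=> -> -> -> ->; ring.
exact: alg E (dtM s1 sd Opp) ode (ds_dt oO sf Opp).
Qed.

(** The two boundary terms are kept apart because they fare differently: [mu'] is designed to remove
    [kin4], while [flux4] only involves the first and second [t]-derivatives of [f], the ones
    prescribed at [T]. *)
Lemma ds_quad4 p : O p -> dt (dt (dt (dt f))) p = omega4 T * f p ->
  ds (quad4 f) p = 2 * (dt (kin4 f) p - dt (flux4 f) p).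
Proof.
move=> Opp ode; have sff := smooth_onM oO sf sf; have s22 := smooth_onM oO s2 s2.
have E : ds (quad4 f) p = omega4 T * (ds f p * f p + f p * ds f p) -
    (ds (dt (dt f)) p * dt (dt f) p + dt (dt f) p * ds (dt (dt f)) p).
  apply: etrans (smooth_deriveD _ (smooth_onMl _ oO sff) (smooth_onN oO s22) Opp) _.
  apply: (congr2 +%R).
    apply: etrans (smooth_deriveMl _ _ sff Opp) _.
    exact: congr1 (dsM sf sf Opp).
  apply: etrans (smooth_deriveN _ s22 Opp) _.
  exact: congr1 (dsM s2 s2 Opp).
have alg (S K' L w x0 x2 x3 x4 d0 d1 d2 y0 y1 : R) :
    S = w * (d0 * x0 + x0 * d0) - (d2 * x2 + x2 * d2) ->
    K' = x4 * d0 + x3 * y0 -> L = x3 * d1 + x2 * y1 -> x4 = w * x0 ->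
    d1 = y0 -> d2 = y1 -> S = 2 * (K' - L).
  by move=> -> -> -> -> -> ->; ring.
exact: alg E (dtM s3 sd Opp) (dtM s2 sd1 Opp) ode (ds_dt oO sf Opp) (ds_dt oO s1 Opp).
Qed.

End QuadraticForms.

(** * The mixed derivative of [mu'] and the boundary terms *)

Section Mu.
Variables H H1 H2 : nat -> 'I_N -> R * R -> R.
Hypothesis bf : boundary_functions H H1 H2.

Definition mu_quad b i p := quad2 (H b i) p + (quad4 (H1 b i) p + quad4 (H2 b i) p).
Definition mu_integrand p := lagr p + 2^-1 * \sum_(i < N) \sum_(b < r) mu_quad b i p.
Definition mu_kin b i p := kin4 (H1 b i) p + kin4 (H2 b i) p.

Lemma smooth_on_mu_quad b i : smooth_on O (mu_quad b i).
Proof.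
exact: (smooth_onD oO (smooth_on_quad2 (bf_smooth bf b i))
  (smooth_onD oO (smooth_on_quad4 (bf_smooth1 bf b i)) (smooth_on_quad4 (bf_smooth2 bf b i)))).
Qed.

Lemma smooth_on_mu_kin b i : smooth_on O (mu_kin b i).
Proof.
exact: (smooth_onD oO (smooth_on_kin4 (bf_smooth1 bf b i)) (smooth_on_kin4 (bf_smooth2 bf b i))).
Qed.

Lemma smooth_on_mu_integrand : smooth_on O mu_integrand.
Proof.
apply: (smooth_onD oO smooth_on_lagr); apply: smooth_onMl oO _.
apply: smooth_on_sum oO _ => i _; apply: smooth_on_sum oO _ => b _.
exact: smooth_on_mu_quad.
Qed.

Lemma muE t s : 0 <= s <= 1 ->
  mu F t s = - \int[lebesgue_measure]_(th in `[0, t]) mu_integrand (th, s).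
Proof.
move=> s1; congr (- _); apply: eq_Rintegral => th _; rewrite njetE; congr (_ + _ * _).
apply: eq_bigr => i _; apply: eq_bigr => b _.
rewrite (bf_h bf i (ltn_ord b) s1) (bf_h1 bf i (ltn_ord b) s1) (bf_h2 bf i (ltn_ord b) s1).
rewrite derive1_slice_t !derive1n_slice_t /=.
have alg (w x y z x0 y0 z0 : R) :
    x ^+ 2 - y ^+ 2 - z ^+ 2 + x0 ^+ 2 + w * y0 ^+ 2 + w * z0 ^+ 2 =
    (x * x + x0 * x0) + ((w * (y0 * y0) - y * y) + (w * (z0 * z0) - z * z)) by ring.
exact: alg.
Qed.

(** The identification of [h'_] and [h''_] with [H1] and [H2] holds for parameters in [[0, 1]], so
    their [s]-derivatives are compared at interior [v], which is enough under the integral. *)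
Lemma mu'E t s : 0 <= t <= T -> 0 <= s <= 1 ->
  mu' F t s = - (\int[lebesgue_measure]_(th in `[0, t]) mu_integrand (th, s)) +
    \sum_(b < r) \sum_(i < N) \int[lebesgue_measure]_(v in `[0, s]) mu_kin b i (t, v).
Proof.
move=> tT s1; rewrite /mu'; apply: (congr2 +%R); first exact: (muE _ s1).
have /andP[s0 s1'] := s1.
apply: eq_bigr => b _; apply: eq_bigr => i _; apply: eq_Rintegral_interior.
  apply: within_itv_cont => v /andP[v0 vs]; apply: cont_slice.
  apply: smooth_on_cont (smooth_on_mu_kin b i) _; apply: Op => //.
  by rewrite v0 (le_trans vs).
move=> v /andP[v0 vs]; have v1 : v < 1 by exact: lt_le_trans s1'.
have vI : 0 <= v <= 1 by rewrite !ltW.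
have nv : nbhs v (`]0, 1[%classic : set R).
  by apply: open_nbhs_nbhs; split; [exact: interval_open|rewrite /= in_itv/= v0 v1].
rewrite (bf_h1 bf i (ltn_ord b) vI) (bf_h2 bf i (ltn_ord b) vI) !derive1n_slice_t.
have E1 : derive1 (fun s' => h'_ F s' b i t) v = ds (H1 b i) (t, v).
  rewrite derive1E -derive_slice_s; apply: near_eq_derive; apply: filterS nv => x.
  by rewrite /= in_itv/= => /andP[x0 x1]; rewrite (bf_h1 bf i (ltn_ord b))// !ltW.
have E2 : derive1 (fun s' => h''_ F s' b i t) v = ds (H2 b i) (t, v).
  rewrite derive1E -derive_slice_s; apply: near_eq_derive; apply: filterS nv => x.
  by rewrite /= in_itv/= => /andP[x0 x1]; rewrite (bf_h2 bf i (ltn_ord b))// !ltW.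
by rewrite E1 E2.
Qed.

Lemma derive1_mu' t s : 0 <= t <= T -> 0 < s < 1 ->
  derive1 (mu' F t) s =
    - (\int[lebesgue_measure]_(th in `[0, t]) ds mu_integrand (th, s)) +
    \sum_(b < r) \sum_(i < N) mu_kin b i (t, s).
Proof.
move=> tT /andP[s0 s1]; have /andP[t0 tT'] := tT.
have ns : nbhs s (`]0, 1[%classic : set R).
  by apply: open_nbhs_nbhs; split; [exact: interval_open|rewrite /= in_itv/= s0 s1].
rewrite derive1E.
rewrite (@near_eq_derive _ _ _ _ (fun s : R =>
  - (\int[lebesgue_measure]_(th in `[0, t]) mu_integrand (th, s)) +
    \sum_(b < r) \sum_(i < N) \int[lebesgue_measure]_(v in `[0, s]) mu_kin b i (t, v))); last first.
  apply: filterS ns => x; rewrite /= in_itv/= => /andP[x0 x1].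
  by apply: mu'E => //; rewrite !ltW.
have sI := smooth_on_mu_integrand.
have OI x y : 0 < x < 1 -> 0 <= y <= t -> O (y, x).
  move=> /andP[x0 x1] /andP[y0 yt]; apply: Op; last by rewrite !ltW.
  by rewrite y0 (le_trans yt).
have dI : is_derive s 1
    (fun s => \int[lebesgue_measure]_(th in `[0, t]) mu_integrand (th, s))
    (\int[lebesgue_measure]_(th in `[0, t]) ds mu_integrand (th, s)).
  apply: (@is_derive_Rintegral _ (fun p => mu_integrand (p.2, p.1))
    (fun p => ds mu_integrand (p.2, p.1)) 0 t 0 1); first by rewrite s0.
  - by move=> x y xI yI; apply: (is_derive_slice_s sI); exact: OI.
  - move=> x y xI yI; apply: cont_swap; apply: smooth_on_cont sI _; exact: OI.
  - move=> x y xI yI; apply: cont_swap.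
    by apply: smooth_on_cont (smooth_on_ds sI) _; exact: OI.
have dk : is_derive s 1
    (fun s => \sum_(b < r) \sum_(i < N) \int[lebesgue_measure]_(v in `[0, s]) mu_kin b i (t, v))
    (\sum_(b < r) \sum_(i < N) mu_kin b i (t, s)).
  apply: is_derive_bigsum => b; apply: is_derive_bigsum => i.
  apply: (@is_derive_Rintegral_upper _ (fun v => mu_kin b i (t, v)) 0 1).
    move=> v v1; apply: cont_slice; apply: smooth_on_cont (smooth_on_mu_kin b i) _.
    exact: Op.
  by rewrite s0.
have [_ ->//] := is_deriveDf (is_deriveN dI) dk.
Qed.

(** The [s]-derivative has already passed under the integral over [th] in [derive1_mu']; the
    [t]-derivative now undoes that integral by the fundamental theorem of calculus. *)
Lemma d2mu'E t s : 0 < t < T -> 0 < s < 1 ->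
  d2mu' F t s = - ds mu_integrand (t, s) + \sum_(b < r) \sum_(i < N) dt (mu_kin b i) (t, s).
Proof.
move=> /andP[t0 tT] s1; have s1' : 0 <= s <= 1 by move: s1 => /andP[? ?]; rewrite !ltW.
have nt : nbhs t (`]0, T[%classic : set R).
  by apply: open_nbhs_nbhs; split; [exact: interval_open|rewrite /= in_itv/= t0 tT].
rewrite /d2mu' derive1E.
rewrite (@near_eq_derive _ _ _ _ (fun t : R =>
  - (\int[lebesgue_measure]_(th in `[0, t]) ds mu_integrand (th, s)) +
    \sum_(b < r) \sum_(i < N) mu_kin b i (t, s))); last first.
  apply: filterS nt => x; rewrite /= in_itv/= => /andP[x0 x1].
  by apply: derive1_mu' => //; rewrite !ltW.
have tI : 0 <= t <= T by rewrite !ltW.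
have sI := smooth_on_ds smooth_on_mu_integrand.
have dI : is_derive t 1
    (fun t => \int[lebesgue_measure]_(th in `[0, t]) ds mu_integrand (th, s))
    (ds mu_integrand (t, s)).
  apply: (@is_derive_Rintegral_upper _ (fun th => ds mu_integrand (th, s)) 0 T).
    by move=> v vT; apply: cont_slice_l; apply: smooth_on_cont sI _; exact: Op.
  by rewrite t0.
have dk : is_derive t 1
    (fun t => \sum_(b < r) \sum_(i < N) mu_kin b i (t, s))
    (\sum_(b < r) \sum_(i < N) dt (mu_kin b i) (t, s)).
  apply: is_derive_bigsum => b; apply: is_derive_bigsum => i.
  by apply: (is_derive_slice_t (smooth_on_mu_kin b i)); exact: Op.
have [_ ->//] := is_deriveDf (is_deriveN dI) dk.
Qed.

Lemma ds_lagr t s : O (t, s) -> ds lagr (t, s) =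
  \sum_(b < n.+1) \sum_(i < N) ds (entry b i) (t, s) * lagr_q b i (t, s) +
  \sum_(a < M) ds (fun p => var_u F p 0 a) (t, s) * lagr_u a (t, s).
Proof.
move=> Ots.
have dfst : ds (fun p : R * R => p.1) (t, s) = 0.
  by rewrite -derive_slice_s derive_cst.
have djets (b : 'I_n.+1) i : ds (fun p => jets p b i) (t, s) = ds (entry b i) (t, s).
  by congr (ds _ _); apply/funext => p; rewrite mxE.
have := derive_jetctl_comp (smooth_on_proj1 (A := O)) sm sw (0, 1)
  (dtL_smooth D) (Jn_jets Ots) Ots.
rewrite -/(ds lagr _) => ->; rewrite -/(ds (fun p : R * R => p.1) (t, s)) dfst mul0r add0r.
apply: (congr2 +%R); last exact: eq_bigr.
apply: eq_bigr => b _; apply: eq_bigr => i _; rewrite /lagr_q inord_val.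
exact: (congr1 (fun x => x * _) (djets b i)).
Qed.

Definition flux b i p := curve_momentum b i p * ds (entry b i) p +
  (flux2 (H b i) p - (flux4 (H1 b i) p + flux4 (H2 b i) p)).

Lemma smooth_on_flux b i : smooth_on O (flux b i).
Proof.
apply: (smooth_onD oO (smooth_onM oO (smooth_on_curve_momentum b i)
  (smooth_on_ds (@smooth_on_entry O b i)))).
exact: (smooth_onB oO (smooth_on_flux2 (bf_smooth bf b i))
  (smooth_onD oO (smooth_on_flux4 (bf_smooth1 bf b i)) (smooth_on_flux4 (bf_smooth2 bf b i)))).
Qed.

Lemma dt_flux b i p : O p -> dt (flux b i) p =
  dt (curve_momentum b i) p * ds (entry b i) p + curve_momentum b i p * ds (entry b.+1 i) p +
  (dt (flux2 (H b i)) p - (dt (flux4 (H1 b i)) p + dt (flux4 (H2 b i)) p)).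
Proof.
move=> Opp; have se := @smooth_on_entry O b i; have sc := smooth_on_curve_momentum b i.
have f0 := smooth_on_flux2 (bf_smooth bf b i).
have f1 := smooth_on_flux4 (bf_smooth1 bf b i).
have f2 := smooth_on_flux4 (bf_smooth2 bf b i).
have f12 := smooth_onD oO f1 f2.
have sce := smooth_onM oO sc (smooth_on_ds se).
apply: etrans (smooth_deriveD _ sce (smooth_onB oO f0 f12) Opp) _.
apply: (congr2 +%R).
  apply: etrans (dtM sc (smooth_on_ds se) Opp) _; apply: (congr2 +%R) => //.
  apply: congr1; apply: etrans (esym (ds_dt oO se Opp)) _.
  by congr (ds _ p); apply/funext => q; exact: dt_entry.
apply: etrans (smooth_deriveD _ f0 (smooth_onN oO f12) Opp) _; apply: congr1.
apply: etrans (smooth_deriveN _ f12 Opp) _; apply: congr1.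
exact: smooth_deriveD _ f1 f2 Opp.
Qed.

Lemma ds_mu_quad b i p : O p -> ds (mu_quad b i) p = 2 * (dt (flux2 (H b i)) p +
  ((dt (kin4 (H1 b i)) p - dt (flux4 (H1 b i)) p) +
   (dt (kin4 (H2 b i)) p - dt (flux4 (H2 b i)) p))).
Proof.
move=> Opp.
have q0 := smooth_on_quad2 (bf_smooth bf b i).
have q1 := smooth_on_quad4 (bf_smooth1 bf b i).
have q2 := smooth_on_quad4 (bf_smooth2 bf b i).
apply: etrans (smooth_deriveD _ q0 (smooth_onD oO q1 q2) Opp) _.
rewrite 2!mulrDr; apply: (congr2 +%R).
  exact: (ds_quad2 (bf_smooth bf b i) Opp (bf_ode bf b i p)).
apply: etrans (smooth_deriveD _ q1 q2 Opp) _; apply: (congr2 +%R).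
  exact: (ds_quad4 (bf_smooth1 bf b i) Opp (bf_ode1 bf b i p)).
exact: (ds_quad4 (bf_smooth2 bf b i) Opp (bf_ode2 bf b i p)).
Qed.

Lemma dt_mu_kin b i p : O p ->
  dt (mu_kin b i) p = dt (kin4 (H1 b i)) p + dt (kin4 (H2 b i)) p.
Proof.
move=> Opp; exact: (smooth_deriveD _ (smooth_on_kin4 (bf_smooth1 bf b i))
  (smooth_on_kin4 (bf_smooth2 bf b i)) Opp).
Qed.

Lemma ds_mu_integrand p : O p -> ds mu_integrand p =
  ds lagr p + \sum_(i < N) \sum_(b < r) (dt (flux2 (H b i)) p +
  ((dt (kin4 (H1 b i)) p - dt (flux4 (H1 b i)) p) +
   (dt (kin4 (H2 b i)) p - dt (flux4 (H2 b i)) p))).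
Proof.
move=> Opp.
pose S i q := \sum_(b < r) mu_quad b i q.
have sS i : smooth_on O (S i).
  by apply: smooth_on_sum oO _ => b _; exact: smooth_on_mu_quad.
have sSS : smooth_on O (fun q => \sum_(i < N) S i q) by apply: smooth_on_sum oO _ => i _; exact: sS.
apply: etrans (smooth_deriveD _ smooth_on_lagr (smooth_onMl 2^-1 oO sSS) Opp) _.
apply: congr1; apply: etrans (smooth_deriveMl _ _ sSS Opp) _.
have D1 : ds (fun q => \sum_(i < N) S i q) p = \sum_(i < N) ds (S i) p.
  exact: (@smooth_derive_sum _ _ O _ (index_enum _) xpredT S (0, 1) p (fun i _ => sS i) Opp).
have D2 i : ds (S i) p = \sum_(b < r) ds (mu_quad b i) p.
  exact: (@smooth_derive_sum _ _ O _ (index_enum _) xpredT (fun b : 'I_r => mu_quad b i) (0, 1) p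
    (fun b _ => smooth_on_mu_quad b i) Opp).
apply: etrans (congr1 _ D1) _; rewrite mulr_sumr; apply: eq_bigr => i _.
apply: etrans (congr1 _ (D2 i)) _; rewrite mulr_sumr; apply: eq_bigr => b _.
by rewrite ds_mu_quad// mulKf.
Qed.

(** Since [calP] is [- L], the term in [Y^a] cancels the control part of [ds lagr]. The jet part is
    rewritten by [lagr_q_ds], and the [kin4] terms of the quadratic part cancel those brought in by
    [mu']. *)
Lemma variation_integrandE t s : 0 < t < T -> 0 < s < 1 ->
  \sum_(a < M) derive1 (fun s' => us F s' t 0 a) s *
     'D_(delta_mx 0 a) (calP D (njet n (qs F s) t)) (us F s t) - d2mu' F t s =
  \sum_(i < N) \sum_(b < r) dt (flux b i) (t, s).
Proof.
move=> tT s1.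
have s1' : 0 <= s <= 1 by move: s1 => /andP[? ?]; rewrite !ltW.
have tT' : 0 <= t <= T by move: tT => /andP[? ?]; rewrite !ltW.
have Ots := Op tT' s1'.
pose U := \sum_(a < M) ds (fun p => var_u F p 0 a) (t, s) * lagr_u a (t, s).
have EU : \sum_(a < M) derive1 (fun s' => us F s' t 0 a) s *
     'D_(delta_mx 0 a) (calP D (njet n (qs F s) t)) (us F s t) = - U.
  rewrite /U -sumrN; apply: eq_bigr => a _; rewrite -mulrN; apply: (congr2 *%R).
    exact: (derive1_slice_s (fun p => var_u F p 0 a)).
  have := smooth_deriveN (0, delta_mx 0 a) (dtL_smooth D)
    (Jn_jets Ots : [set xw | Jn Q xw.1] ((t, jets (t, s)), var_u F (t, s))).
  move=> <-; rewrite njetE; apply: eq_derive_line => [h|//].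
  rewrite /calP; congr (- dtL D _); apply/pair_equal_spec; split => //=.
  by rewrite scaler0 add0r.
have alg (L B K' G : R) : L + B - K' = G -> - U - (- (L + U + B) + K') = G by move=> <-; ring.
rewrite EU (d2mu'E tT s1) (ds_mu_integrand Ots) (ds_lagr Ots) -/U.
apply: alg; rewrite lagr_q_ds// [X in _ - X]exchange_big -big_split -sumrB.
apply: eq_bigr => i _; rewrite /= -big_split -sumrB; apply: eq_bigr => b _.
rewrite /= (dt_flux b i Ots) (dt_mu_kin b i Ots).
have alg2 (A f0 f1 f2 k1 k2 : R) :
    A + (f0 + ((k1 - f1) + (k2 - f2))) - (k1 + k2) = A + (f0 - (f1 + f2)) by ring.
exact: alg2.
Qed.

Lemma flux_increment b i s : (b < r)%N -> 0 <= s <= 1 ->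
  flux b i (T, s) - flux b i (0, s) = - (ds (entry b i) (T, s) * cost_q b i (T, s)).
Proof.
move=> br s1.
(* The boundary conditions on [H], [H1], [H2] hold for every real [s], so they may be differentiated
   in [s] even at [s = 0] and [s = 1]. *)
have eq_ds (f g : R * R -> R) (t0 : R) :
    (forall s, f (t0, s) = g (t0, s)) -> ds f (t0, s) = ds g (t0, s).
  by move=> fg; rewrite -!derive_slice_s; congr ('D_1 _ s); apply/funext.
have ds0 (f : R * R -> R) (t0 : R) : (forall s, f (t0, s) = 0) -> ds f (t0, s) = 0.
  move=> f0; rewrite -derive_slice_s (_ : (fun s => _) = fun=> 0) ?derive_cst//.
  exact/funext.
have e1 : ds (H b i) (0, s) = ds (entry b i) (0, s).
  by apply: eq_ds => s'; have [] := bf_at0 bf b i s'.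
have e2 : ds (dt (H1 b i)) (0, s) = 0 by apply: ds0 => s'; exact: (bf_at01 bf b i s').
have e3 : ds (dt (H2 b i)) (0, s) = 0 by apply: ds0 => s'; exact: (bf_at02 bf b i s').
have e4 : ds (dt (H1 b i)) (T, s) = ds (entry b i) (T, s).
  by apply: eq_ds => s'; have [] := bf_atT1 bf b i s'.
have e5 : ds (dt (H2 b i)) (T, s) = ds (H b i) (T, s).
  by apply: eq_ds => s'; have [] := bf_atT2 bf b i s'.
have [_ c1] := bf_at0 bf b i s; have [_ c2] := bf_atT1 bf b i s.
have [_ c3] := bf_atT2 bf b i s.
have alg (m0 e0 h0 g0 x1 y1 x2 y2 mT eT hT gT z1 w1 z2 w2 q : R) :
    g0 = e0 -> y1 = 0 -> y2 = 0 -> w1 = eT -> w2 = gT -> h0 = - m0 -> z1 = mT + q ->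
    z2 = hT ->
    mT * eT + (hT * gT - (z1 * w1 + z2 * w2)) - (m0 * e0 + (h0 * g0 - (x1 * y1 + x2 * y2)))
    = - (eT * q).
  by move=> -> -> -> -> -> -> -> ->; ring.
exact: (alg _ _ _ _ _ _ _ _ _ _ _ _ _ _ _ _ _ e1 e2 e3 e4 e5 c1 c2 c3).
Qed.

(** The integrand is identified on the open rectangle only, which suffices for each of the nested
    integrals; its replacement [G] is continuous up to the boundary, so the rectangle formula
    applies to it. *)
Lemma variation_integral_flux :
  variation_integral F = \int[lebesgue_measure]_(s in `[0, 1])
    (\sum_(i < N) \sum_(b < r) flux b i (T, s) - \sum_(i < N) \sum_(b < r) flux b i (0, s)).
Proof.
pose Phi p := \sum_(i < N) \sum_(b < r) flux b i p.
pose G p := \sum_(i < N) \sum_(b < r) dt (flux b i) p.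
have sP : smooth_on O Phi.
  apply: smooth_on_sum oO _ => i _; apply: smooth_on_sum oO _ => b _.
  exact: smooth_on_flux.
have sG : smooth_on O G.
  apply: smooth_on_sum oO _ => i _; apply: smooth_on_sum oO _ => b _.
  exact: smooth_on_dt (smooth_on_flux b i).
have cont (f : R * R -> R) : smooth_on O f -> forall x y, 0 <= x <= T -> 0 <= y <= 1 ->
    {for (x, y), continuous f}.
  by move=> sf x y xT y1; apply: smooth_on_cont sf _; exact: Op.
have dPhi x y : 0 < x < T -> 0 <= y <= 1 ->
    is_derive x 1 (fun x => Phi (x, y)) (G (x, y)).
  move=> xT y1; have xT' : 0 <= x <= T by move: xT => /andP[? ?]; rewrite !ltW.
  apply: is_derive_bigsum => i; apply: is_derive_bigsum => b.
  by apply: (is_derive_slice_t (smooth_on_flux b i)); exact: Op.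
have FT := Rintegral_rectangle_derive T_gt0 (cont _ sP) (cont _ sG) dPhi.
apply: etrans FT; apply: eq_Rintegral_interior.
  exact: cont_Rintegral (cont _ sG).
move=> t tT; apply: eq_Rintegral_interior.
  apply: within_itv_cont => s s1; apply: cont_slice; apply: (cont _ sG) => //.
  by move: tT => /andP[? ?]; rewrite !ltW.
by move=> s s1; exact: variation_integrandE.
Qed.

Lemma variation_integral_boundary : variation_integral F = cost (T, 0) - cost (T, 1).
Proof.
have TT : 0 <= T <= T by rewrite lexx ltW.
have sc := smooth_on_cost.
have kc s : 0 <= s <= 1 -> {for s, continuous (fun s => - cost (T, s))}.
  move=> s1; apply: (@cont_slice _ (fun p => - cost p)).
  by apply: smooth_on_cont (smooth_onN oO sc) _; exact: Op.
have dkc s : 0 <= s <= 1 -> {for s, continuous (fun s => - ds cost (T, s))}.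
  move=> s1; apply: (@cont_slice _ (fun p => - ds cost p)).
  by apply: smooth_on_cont (smooth_onN oO (smooth_on_ds sc)) _; exact: Op.
rewrite variation_integral_flux.
transitivity (\int[lebesgue_measure]_(s in `[0, 1]) (- ds cost (T, s))).
  apply: eq_Rintegral => s; rewrite inE/= in_itv/= => s1.
  have E : ds cost (T, s) =
      \sum_(i < N) \sum_(b < r) ds (entry b i) (T, s) * cost_q b i (T, s).
    by apply: etrans (ds_cost s1) _; exact: exchange_big.
  apply: etrans _ (esym (congr1 -%R E)); rewrite -sumrB -sumrN.
  apply: eq_bigr => i _; rewrite -sumrB -sumrN; apply: eq_bigr => b _.
  exact: flux_increment.
have d (s : R) : 0 < s < 1 -> is_derive s 1 (fun s => - cost (T, s)) (- ds cost (T, s)).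
  move=> s1; apply: is_deriveN; apply: (is_derive_slice_s sc); apply: Op => //.
  by move: s1 => /andP[? ?]; rewrite !ltW.
apply: etrans (Rintegral_derive ltr01 (within_itv_cont kc) (within_itv_cont dkc) d) _.
by rewrite opprK addrC.
Qed.

End Mu.

Lemma variation_integral_cost :
  variation_integral F = terminal_cost D (qs F 0) - terminal_cost D (qs F 1).
Proof.
have [H [H1 [H2 bf]]] := boundary_functions_exist.
by rewrite (variation_integral_boundary bf) /terminal_cost !njetE.
Qed.

End VariationCalculus.

(** Curves are compared on [[0, T]] only, whereas [njet] at [T] uses two-sided derivatives of their
    extensions; smoothness makes these one-sided information. *)
Lemma eq_terminal_cost {R : realType} {T : R} {N M n r rt : nat} {Q : set 'rV[R]_N}
    {K : set 'rV[R]_M} (D : defining_triple T n r rt Q K) (q q' : R -> 'rV[R]_N) :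
  0 < T -> smooth_on setT q -> smooth_on setT q' ->
  (forall t, 0 <= t <= T -> q t = q' t) -> terminal_cost D q = terminal_cost D q'.
Proof.
move=> T0 sq sq' qq'; rewrite /terminal_cost /njet; congr (dtC D (_, _)).
apply/matrixP => b i; rewrite !mxE.
by rewrite (eq_derive1n_closed b T0 sq sq' qq') // lexx ltW.
Qed.

Unset Implicit Arguments.

Theorem theorem6p6 (R : realType) (T : R) (N M n r rt : nat)
    (Q : set 'rV[R]_N) (K : set 'rV[R]_M)
    (T_gt0 : 0 < T) (Q_open : open Q) (K_dom : control_domain K)
    (D : defining_triple T n r rt Q K) (rt_lt_r : (rt < r)%N)
    (Uo : control_pair N M r) (qo : R -> 'rV[R]_N)
    (qo_curve : is_curve_of D Uo qo) :
  (mayer_solution D qo ->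
     forall F : controlled_variation D,
       (forall t, t \in `[0, T] -> var_F F (t, 0) = qo t) ->
       variation_integral F <= 0)
  /\
  ((forall U U' q q', is_curve_of D U q -> is_curve_of D U' q' ->
      exists F : controlled_variation D, has_endpoints F q q') ->
   (forall F : controlled_variation D,
      (forall t, t \in `[0, T] -> var_F F (t, 0) = qo t) ->
      variation_integral F <= 0) ->
   mayer_solution D qo).
Proof.
have I0 : (0 : R) \in `[0, 1] by rewrite in_itv/= lexx ler01.
have I1 : (1 : R) \in `[0, 1] by rewrite in_itv/= lexx ler01.
have sqo : smooth_on setT qo by have [_ []] := qo_curve.
have start (F : controlled_variation D) : (forall t, t \in `[0, T] -> var_F F (t, 0) = qo t) ->
    variation_integral F = terminal_cost D qo - terminal_cost D (qs F 1).
  move=> F0; rewrite (variation_integral_cost T_gt0 Q_open F rt_lt_r); congr (_ - _).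
  by apply: eq_terminal_cost => //; have [_ []] := var_curve F I0.
split=> [sol F F0|conn cond U q' cq'].
  (* The end curve of a variation is itself controlled, hence a competitor of [qo]. *)
  by rewrite start// subr_le0; apply: sol (var_curve F I1).
(* Conversely, any competitor is the end of a variation starting at [qo], and the sign condition for
   that variation compares the two costs. *)
have [F Fq] := conn Uo U qo q' qo_curve cq'.
have F0 t : t \in `[0, T] -> var_F F (t, 0) = qo t by move=> /Fq[].
have := cond F F0; rewrite start// subr_le0.
rewrite (@eq_terminal_cost _ _ _ _ _ _ _ _ _ D (qs F 1) q')//.
- by have [_ []] := var_curve F I1.
- by have [_ []] := cq'.
- by move=> t tT; have [] := Fq t tT.
Qed.
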